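(* Let $\omega$ be a non-principal ultrafilter on $\mathbb{N}$, $\{A_i\}$ compact abelian groups and $\mathbf{A}=\prod_\omega A_i$. A function $f\in L^\infty(\mathbf{A})$ is measurable with respect to the Fourier $\sigma$-algebra $\mathcal{F}(\mathbf{A})$ if and only if there exist a second countable compact abelian group $A$, a continuous surjective measure preserving homomorphism $\phi:\mathbf{A}\to A$ and a function $h\in L^\infty(A)$ such that $f=h\circ\phi$ almost everywhere. Furthermore, in this case the Fourier transform $\hat h\in l^2(\hat A)$ is isomorphic to the Fourier transform $\hat f\in l^2(\hat{\mathbf{A}})$ (equivalently $d(h,\mathcal{Q}(f))=0$).
   Context: Compact abelian groups carry normalized Haar measure. $\mathbf{A}=\prod_\omega A_i$ is the ultraproduct group (sequences $(x_i)$, $x_i\in A_i$, modulo agreement on a set in $\omega$). For compact Hausdorff $T$ and $f_i:A_i\to T$, $\lim_\omega f_i$ is the function on $\mathbf{A}$ with value $\lim_\omega f_i(x_i)$ at the class of $(x_i)$. Strongly open sets are ultraproducts of open sets $S_i\subseteq A_i$; open sets are countable unions of strongly open sets; continuity of a map from $\mathbf{A}$ means preimages of open sets are open. The ultralimit measure $\mu$ on the $\sigma$-algebra generated by strongly open sets satisfies $\mu(\prod_\omega S_i)=\lim_\omega\mu_{A_i}(S_i)$; ''measure preserving'' for $\phi$ means $\mu(\phi^{-1}(S))$ equals the Haar measure of $S$ for Borel $S\subseteq A$. A linear character of $\mathbf{A}$ is a continuous homomorphism $\mathbf{A}\to\{|z|=1\}$; they form a group $\hat{\mathbf{A}}$.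 $\mathcal{F}(\mathbf{A})$ is the $\sigma$-algebra generated by linear characters. For $f\in L^2(\mathbf{A})$, $\hat f\in l^2(\hat{\mathbf{A}})$ is $\hat f(\chi)=\int f\overline{\chi}\,d\mu$. For a group $G$ and $f\in l^2(G)$, $\langle f\rangle$ is the subgroup generated by $\{g:f(g)\neq0\}$; $f_1\in l^2(G_1)$, $f_2\in l^2(G_2)$ are isomorphic if there is a group isomorphism $\alpha:\langle f_1\rangle\to\langle f_2\rangle$ with $f_1=f_2\circ\alpha$ on $\langle f_1\rangle$. $\mathcal{Q}(f)$ denotes the isomorphism class of functions on compact abelian groups whose Fourier transform is isomorphic to $\hat f$, and $d(f_1,f_2)=\hat d(\hat f_1,\hat f_2)$ where $\hat d(u,v)=0$ iff $u,v$ are isomorphic. *)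

(* Defs.v *)
From HB Require Import structures.
From mathcomp Require Import all_boot all_order all_algebra.
From mathcomp Require Import generic_quotient ring_quotient complex.
From mathcomp Require Import all_classical all_reals all_analysis.

Set Implicit Arguments.
Unset Strict Implicit.
Unset Printing Implicit Defensive.

From mathcomp Require Import lra.

Import Order.TTheory GRing.Theory Num.Theory.
Import numFieldTopology.Exports numFieldNormedType.Exports.

Local Open Scope classical_set_scope.
Local Open Scope ring_scope.

Definition C (R : realType) : numClosedFieldType := R[i].

Section ComplexTopology.
Context {R : realType}.

Lemma natVC (n : nat) : (n.+1%:R^-1 : R[i]) = (n.+1%:R^-1 : R)%:C%C.
Proof. by rewrite fmorphV rmorph_nat. Qed.

Lemma gt0_natC (e : R[i]) : 0 < e -> exists n : nat, n.+1%:R^-1 < e.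
Proof.
case: e => a b; rewrite ltcE /= => /andP[/eqP -> a0].
exists (Num.truncn a^-1); rewrite natVC ltcR.
rewrite invf_plt ?posrE ?ltr0n//.
by have := truncnS_gt a^-1.
Qed.

Lemma C_rat_dense (z : R[i]) (n : nat) : exists p : rat * rat,
  `|z - Complex (ratr p.1 : R) (ratr p.2)| < n.+1%:R^-1.
Proof.
case: z => a b; pose d : R := (n.+1%:R)^-1 / 2.
have d0 : 0 < d by rewrite divr_gt0// invr_gt0 ltr0n.
have H (x : R) : exists q : rat, `|x - ratr q| < d.
  have /rat_in_itvoo[q] : x - d < x + d by lra.
  rewrite in_itv/= => /andP[h1 h2]; exists q.
  by rewrite ltr_norml; lra.
have [q hq] := H a; have [r hr] := H b; exists (q, r).
have -> : Complex a b - Complex (ratr q) (ratr r) =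
  (a - ratr q)%:C%C + 'i%C * (b - ratr r)%:C%C.
  by rewrite [LHS]complexE.
apply: (le_lt_trans (ler_normD _ _)).
rewrite normrM !normc_def /= !expr0n !expr1n /= !addr0 add0r !sqrtr_sqr sqrtr1.
rewrite mul1r natVC -rmorphD ltcR.
by rewrite (splitr n.+1%:R^-1) ltrD.
Qed.

Lemma C_base : exists B : nat -> set (C R), (forall n, open (B n)) /\
  forall z U, nbhs z U -> exists2 n, B n z & B n `<=` U.
Proof.
pose D (k : rat * rat * nat) : set (C R) :=
  ball (Complex (ratr k.1.1) (ratr k.1.2) : C R) (k.2.+1%:R^-1).
exists (fun n => if unpickle n is Some k then D k else set0); split.
  move=> n; case: unpickle => [k|]; last exact: open0.
  by apply: ball_open; rewrite invr_gt0 ltr0n.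
move=> z U /nbhs_ballP[e /= e0 eU].
have [n ne] := gt0_natC (divr_gt0 e0 (ltr0n _ 2) : 0 < e / 2).
have [p hp] := C_rat_dense z n.
exists (pickle (p, n)); rewrite pickleK /D /=.
  by rewrite /ball /= distrC.
move=> y; rewrite /ball/= => hy; apply: eU; rewrite /ball /=.
set q := Complex _ _ in hp hy.
have -> : z - y = (z - q) + (q - y) by rewrite addrA subrK.
apply: (le_lt_trans (ler_normD _ _)); rewrite [e]splitr ltrD//.
  exact: lt_trans hp _.
exact: lt_trans hy _.
Qed.

Lemma open_conjC (U : set (C R)) : open U -> open ((fun z : C R => z^*) @^-1` U).
Proof.
rewrite !openE => oU z /= /oU /nbhs_ballP[e /= e0 eU].
apply/nbhs_ballP; exists e => //= y; rewrite /ball /= => hy.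
by apply: eU; rewrite /ball /= -rmorphB norm_conjC.
Qed.

End ComplexTopology.

(* The open sets of an ultraproduct are only closed under countable unions, so
   continuity of characters is stated for such families of sets. *)
Record sigma_topology (T : Type) := SigmaTopology {
  sopen : set (set T) ;
  sopen0 : sopen set0 ;
  sopenT : sopen setT ;
  sopenI : forall U V, sopen U -> sopen V -> sopen (U `&` V) ;
  sopen_bigcup : forall F : nat -> set T,
    (forall n, sopen (F n)) -> sopen (\bigcup_n F n) }.

Definition topology_sigma (T : topologicalType) : sigma_topology T :=
  SigmaTopology (@open0 T) (@openT T) (@openI T)
    (fun F oF => bigcup_open (fun n _ => oF n)).

(* A measurableType needs a point, which the topologicalZmodType's and the
   ultraproduct below do not carry: we use 0. *)
Definition zpointed (G : zmodType) : Type := G.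
HB.instance Definition _ (G : zmodType) := GRing.Zmodule.on (zpointed G).
HB.instance Definition _ (G : zmodType) := isPointed.Build (zpointed G) 0.

Notation gen_sigma G S := (@g_sigma_algebraType (zpointed G) S).
Notation borel A := (gen_sigma A (@open A)).
Notation borelC R := (g_sigma_algebraType (@open (C R))).

Section ComplexIntegration.
Context d (T : measurableType d) (R : realType).
Variable m : {measure set T -> \bar R}.

Definition Lp_function (p : \bar R) (f : T -> C R) : Prop :=
  measurable_fun setT (f : T -> borelC R) /\
  ('N[m]_p [(fun x => (Normc.normc (f x))%:E)] < +oo)%E.

Definition Cintegral (f : T -> C R) : C R :=
  Complex (\int[m]_x complex.Re (f x))
          (\int[m]_x complex.Im (f x)).

End ComplexIntegration.

Definition linear_character (R : realType) (G : zmodType)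
    (O : sigma_topology G) (chi : G -> C R) : Prop :=
  [/\ forall x, `|chi x| = 1,
      forall x y, chi (x + y) = chi x * chi y &
      forall U : set (C R), open U -> sopen O (chi @^-1` U)].

Section Dual.
Context {R : realType} {G : zmodType} {O : sigma_topology G}.
Implicit Types chi : G -> C R.

Lemma linear_character1 : linear_character O (fun=> 1 : C R).
Proof.
split=> [x|x y|U oU]; rewrite ?normr1 ?mulr1//.
rewrite -[X in X @^-1` _]/(cst 1) preimage_cst.
by case: ifP => _; [exact: sopenT|exact: sopen0].
Qed.

Lemma linear_characterJ chi :
  linear_character O chi -> linear_character O (fun x => (chi x)^*).
Proof.
case=> chi1 chiD chiO; split=> [x|x y|U oU]; first by rewrite norm_conjC.
  by rewrite chiD rmorphM.
exact: (chiO _ (open_conjC oU)).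
Qed.

Lemma linear_characterM chi1 chi2 :
  linear_character O chi1 -> linear_character O chi2 ->
  linear_character O (fun x => chi1 x * chi2 x).
Proof.
move=> [n1 D1 O1] [n2 D2 O2]; split=> [x|x y|W oW].
- by rewrite normrM n1 n2 mulr1.
- by rewrite D1 D2 mulrACA.
have [B [oB nB]] := @C_base R.
pose P (k : nat * nat) := forall a b, B k.1 a -> B k.2 b -> W (a * b).
pose F n := if unpickle n is Some k then
  if `[< P k >] then chi1 @^-1` B k.1 `&` chi2 @^-1` B k.2 else set0 else set0.
rewrite (_ : _ @^-1` _ = \bigcup_n F n).
  apply: sopen_bigcup => n; rewrite /F; case: unpickle => [k|]; last exact: sopen0.
  case: ifP => _; last exact: sopen0.
  by apply: sopenI; [exact: O1|exact: O2].
apply/seteqP; split=> [x Wx|x [n _]]; last first.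
  rewrite /F; case: unpickle => [k|//]; case: asboolP => // Pk [/= b1 b2].
  exact: Pk.
have : nbhs (chi1 x * chi2 x) W by exact: open_nbhs_nbhs.
move=> /(@mul_continuous (C R) (chi1 x, chi2 x))[[U V]/= [nU nV] UV].
have [i xi iU] := nB _ _ nU; have [j xj jV] := nB _ _ nV.
exists (pickle (i, j)) => //; rewrite /F pickleK asboolT//.
by move=> a b /iU Ua /jV Vb; exact: (UV (a, b)).
Qed.

End Dual.

Record dual (R : realType) (G : zmodType) (O : sigma_topology G) := Dual {
  dual_fun :> G -> C R ;
  _ : `[< linear_character O dual_fun >] }.

Section DualGroup.
Context {R : realType} {G : zmodType} {O : sigma_topology G}.
Local Notation dual := (dual R O).

HB.instance Definition _ := [isSub for @dual_fun R G O].
HB.instance Definition _ := [Choice of dual by <:].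

Lemma dualP (chi : dual) : linear_character O chi.
Proof. by case: chi => chi /= /asboolP. Qed.

Definition dual_one : dual := Dual (asboolT linear_character1).
Definition dual_inv (chi : dual) : dual :=
  Dual (asboolT (linear_characterJ (dualP chi))).
Definition dual_mul (chi psi : dual) : dual :=
  Dual (asboolT (linear_characterM (dualP chi) (dualP psi))).

Lemma dual_mulA : associative dual_mul.
Proof. by move=> a b c; apply/val_inj/funext => x /=; rewrite mulrA. Qed.

Lemma dual_mulC : commutative dual_mul.
Proof. by move=> a b; apply/val_inj/funext => x /=; rewrite mulrC. Qed.

Lemma dual_mul1 : left_id dual_one dual_mul.
Proof. by move=> a; apply/val_inj/funext => x /=; rewrite mul1r. Qed.

Lemma dual_mulV : left_inverse dual_one dual_inv dual_mul.
Proof.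
move=> a; apply/val_inj/funext => x /=; rewrite mulrC -normCK.
by have [-> _ _] := dualP a; rewrite expr1n.
Qed.

Lemma dual_mul1r : right_id dual_one dual_mul.
Proof. by move=> a; rewrite dual_mulC dual_mul1. Qed.

Lemma dual_mulVr : right_inverse dual_one dual_inv dual_mul.
Proof. by move=> a; rewrite dual_mulC dual_mulV. Qed.

HB.instance Definition _ :=
  isGroup.Build dual dual_mulA dual_mul1 dual_mul1r dual_mulV dual_mulVr.

End DualGroup.

Definition fourier (R : realType) (G : zmodType) (S : set (set G))
    (m : {measure set (gen_sigma G S) -> \bar R}) (O : sigma_topology G)
    (f : G -> C R) : dual R O -> C R :=
  fun chi => Cintegral m (fun x => f x * (chi x)^*).

Section L2Groups.
Context {R : realType}.

Definition ell2 (G : groupType) (f : G -> C R) : Prop :=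
  (\esum_(g in [set: G]) ((Normc.normc (f g)) ^+ 2)%:E < +oo)%E.

Definition spt_subgroup (G : groupType) (f : G -> C R) : set G :=
  smallest [set H : set G | group_closed (mem H)] [set g | f g != 0].

Definition ell2_isomorphic (G1 G2 : groupType)
    (f1 : G1 -> C R) (f2 : G2 -> C R) : Prop :=
  [/\ ell2 f1, ell2 f2 &
    exists alpha : G1 -> G2,
      [/\ set_bij (spt_subgroup f1) (spt_subgroup f2) alpha,
          {in spt_subgroup f1 &, {morph alpha : g h / (g * h)%g}} &
          {in spt_subgroup f1, forall g, f1 g = f2 (alpha g)}]].

End L2Groups.

Definition compact_group (A : topologicalZmodType) : Prop :=
  compact [set: A] /\ hausdorff_space A.

(* Haar measure is the regular invariant Borel probability: without second
   countability, invariance alone does not determine it. *)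
Definition is_haar (R : realType) (A : topologicalZmodType)
    (m : probability (borel A) R) : Prop :=
  [/\ forall (a : A) (S : set (borel A)), measurable S ->
        m ((fun x : A => a + x) @^-1` S) = m S,
      forall S : set (borel A), measurable S ->
        m S = ereal_inf [set m U | U in [set U : set A | open U /\ S `<=` U]] &
      forall S : set (borel A), measurable S ->
        m S = ereal_sup [set m K | K in [set K : set A | compact K /\ K `<=` S]]].

Definition sequences (A : nat -> topologicalZmodType) : Type := forall i, A i.

Section Sequences.
Variable A : nat -> topologicalZmodType.
Implicit Types x y : sequences A.

HB.instance Definition _ := Choice.copy (sequences A) (forall i, A i).

Definition seq_zero : sequences A := fun=> 0.
Definition seq_opp x : sequences A := fun i => - x i.
Definition seq_add x y : sequences A := fun i => x i + y i.

Lemma seq_addA : associative seq_add.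
Proof. by move=> x y z; apply/functional_extensionality_dep => i; exact: addrA. Qed.

Lemma seq_addC : commutative seq_add.
Proof. by move=> x y; apply/functional_extensionality_dep => i; exact: addrC. Qed.

Lemma seq_add0 : left_id seq_zero seq_add.
Proof. by move=> x; apply/functional_extensionality_dep => i; exact: add0r. Qed.

Lemma seq_addN : left_inverse seq_zero seq_opp seq_add.
Proof. by move=> x; apply/functional_extensionality_dep => i; exact: addNr. Qed.

HB.instance Definition _ := GRing.isZmodule.Build (sequences A)
  seq_addA seq_addC seq_add0 seq_addN.

End Sequences.

Section Ultraproduct.
Variables (w : set_system nat) (wU : UltraFilter w).
Variable A : nat -> topologicalZmodType.

Definition null_seq of UltraFilter w : pred (sequences A) :=
  fun x => `[< \forall i \near w, x i = 0 >].

Lemma null_seq_closed : zmod_closed (null_seq wU).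
Proof.
split=> [|x y]; rewrite !unfold_in; first by apply/asboolP/nearW.
move=> /asboolP x0 /asboolP y0; apply/asboolP.
near=> i; rewrite /= (_ : (x - y) i = x i - y i)//.
by rewrite (near x0 i)// (near y0 i)// subrr.
Unshelve. all: by end_near. Qed.

HB.instance Definition _ :=
  GRing.isZmodClosed.Build (sequences A) (null_seq wU) null_seq_closed.

(* The cosets of the null sequences are the classes of sequences modulo
   agreement on a set of w. *)
Definition ultraproduct : Type :=
  Quotient.quot (GRing.ZmodClosed.clone _ (null_seq wU) _).

HB.instance Definition _ := GRing.Zmodule.on ultraproduct.
HB.instance Definition _ := ZmodQuotient.on ultraproduct.

Definition uclass (x : sequences A) : ultraproduct := (\pi_ultraproduct x)%qT.

(* The classes with some representative lying in S i for w-almost all i;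
   requiring it for all i would give set0 as soon as one S i is empty. *)
Definition uprod (S : forall i, set (A i)) : set ultraproduct :=
  [set uclass x | x in [set x | \forall i \near w, S i (x i)]].

Definition strongly_open : set (set ultraproduct) :=
  [set uprod S | S in [set S | forall i, open (S i)]].

Definition uopen : set (set ultraproduct) :=
  [set U | exists2 F : nat -> set ultraproduct,
     (forall n, strongly_open (F n)) & U = \bigcup_n F n].

Lemma uclassP x y : uclass x = uclass y <-> \forall i \near w, x i = y i.
Proof.
have E : (uclass x = uclass y) <-> \forall i \near w, (x - y) i = 0.
  split=> [/eqP|xy]; last apply/eqP.
    by rewrite /uclass -Quotient.idealrBE => /asboolP.
  by rewrite /uclass -Quotient.idealrBE; apply/asboolP.
rewrite E; split; apply: filterS => i; rewrite (_ : (x - y) i = x i - y i)//.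
  by move/eqP; rewrite subr_eq0 => /eqP.
by move=> ->; rewrite subrr.
Qed.

Lemma uprodI S T : uprod S `&` uprod T = uprod (fun i => S i `&` T i).
Proof.
apply/seteqP; split=> [_ [[x xS <-] [y yT]]|_ [x xST <-]].
  move=> /uclassP yx; exists x => //=.
  by move: xS yT yx; apply: filterS3 => i Si + e; rewrite e; split.
by split; exists x => //; move: xST; apply: filterS => i [].
Qed.

Lemma strongly_open0 : strongly_open set0.
Proof.
exists (fun=> set0) => [i|]; first exact: open0.
by apply/seteqP; split=> [a [x /= /filter_ex x0 _]|//]; case: x0.
Qed.

Lemma strongly_openT : strongly_open setT.
Proof.
exists (fun=> setT) => [i|]; first exact: openT.
apply/seteqP; split=> // a _; exists (repr a); last exact: reprK.
exact: nearW.
Qed.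

Lemma strongly_openI U V :
  strongly_open U -> strongly_open V -> strongly_open (U `&` V).
Proof.
move=> [S oS <-] [T oT <-]; rewrite uprodI; exists (fun i => S i `&` T i) => //.
by move=> i; apply: openI.
Qed.

Lemma strongly_open_uopen U : strongly_open U -> uopen U.
Proof. by move=> oU; exists (fun=> U) => //; rewrite bigcup_const. Qed.

Lemma uopen_bigcup (F : nat -> set ultraproduct) :
  (forall n, uopen (F n)) -> uopen (\bigcup_n F n).
Proof.
move=> oF; have /choice[G GP] : forall n, exists G : nat -> set ultraproduct,
    (forall k, strongly_open (G k)) /\ F n = \bigcup_k G k.
  by move=> n; have [G oG ->] := oF n; exists G.
exists (fun n => if unpickle n is Some k then G k.1 k.2 else set0).
  by move=> n; case: unpickle => [k|]; [case: (GP k.1)|exact: strongly_open0].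
apply/seteqP; split=> [a [n _]|a [n _]].
  have [_ ->] := GP n; move=> [k _ ak]; exists (pickle (n, k)) => //=.
  by rewrite pickleK.
case: unpickle => [k ak|//]; exists k.1 => //; have [_ ->] := GP k.1.
by exists k.2.
Qed.

Lemma uopenI U V : uopen U -> uopen V -> uopen (U `&` V).
Proof.
move=> [F oF ->] [G oG ->]; rewrite setI_bigcupl; apply: uopen_bigcup => n.
rewrite setI_bigcupr; apply: uopen_bigcup => k.
by apply: strongly_open_uopen; apply: strongly_openI.
Qed.

Definition uopen_sigma : sigma_topology ultraproduct :=
  SigmaTopology (strongly_open_uopen strongly_open0)
    (strongly_open_uopen strongly_openT) uopenI uopen_bigcup.

End Ultraproduct.

Arguments strongly_open {w} wU A.

Section FourierSigmaAlgebra.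
Context {R : realType} {w : set_system nat} {wU : UltraFilter w}.
Context {A : nat -> topologicalZmodType}.
Local Notation AA := (ultraproduct wU A).
Local Notation SO := (strongly_open wU A).
Implicit Types (mu : probability (gen_sigma AA SO) R) (f : AA -> C R).

Definition ultralimit_measure (m : forall i, probability (borel (A i)) R) mu :
    Prop :=
  forall S : forall i, set (A i), (forall i, open (S i)) ->
    m i (S i) @[i --> w] --> mu (@uprod w wU A S).

Definition fourier_generators : set (set AA) :=
  [set V | exists chi : dual R (uopen_sigma wU A),
     exists2 U : set (C R), open U & V = chi @^-1` U].

(* An element of L^oo is a class of functions modulo null sets, so it is
   measurable when some representative is. *)
Definition fourier_measurable mu f : Prop :=
  exists2 g : AA -> C R,
    measurable_fun setT (g : gen_sigma AA fourier_generators -> borelC R) &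
    {ae mu, forall x, f x = g x}.

Definition measure_preserving mu (B : topologicalZmodType)
    (mB : probability (borel B) R) (phi : AA -> B) : Prop :=
  forall S : set (borel B), measurable S -> mu (phi @^-1` S) = mB S.

Definition factorization mu f (B : topologicalZmodType)
    (mB : probability (borel B) R) (phi : AA -> B) (h : B -> C R) : Prop :=
  [/\ [/\ compact_group B, @second_countable B & is_haar mB],
      [/\ {morph phi : x y / x + y},
          forall U : set B, open U -> uopen (phi @^-1` U),
          set_surj setT setT phi &
          measure_preserving mu mB phi],
      Lp_function mB +oo h &
      {ae mu, forall x, f x = h (phi x)}].

Definition ufourier mu f : dual R (uopen_sigma wU A) -> C R :=
  fourier mu f.

End FourierSigmaAlgebra.

Definition cfourier (R : realType) (B : topologicalZmodType)
    (mB : probability (borel B) R) (h : B -> C R) :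
    dual R (topology_sigma B) -> C R :=
  fourier mB h.

Section Distance.
Context {R : realType}.

(* Any distance on square-summable functions on groups which vanishes exactly
   on isomorphic pairs. *)
Definition ell2_metric
    (dhat : forall G1 G2 : groupType, (G1 -> C R) -> (G2 -> C R) -> R) : Prop :=
  forall (G1 G2 : groupType) (u : G1 -> C R) (v : G2 -> C R),
    ell2 u -> ell2 v -> (dhat G1 G2 u v = 0 <-> ell2_isomorphic u v).

Definition in_Q (w : set_system nat) (wU : UltraFilter w)
    (A : nat -> topologicalZmodType)
    (mu : probability (gen_sigma (ultraproduct wU A) (strongly_open wU A)) R)
    (f : ultraproduct wU A -> C R)
    (B : topologicalZmodType) (mB : probability (borel B) R) (k : B -> C R) :
    Prop :=
  [/\ compact_group B, is_haar mB, Lp_function mB 2%:E k &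
      ell2_isomorphic (cfourier mB k) (ufourier mu f)].

End Distance.

(* Main.v *)
(* A function measurable for the Fourier sigma-algebra depends on countably many
   characters; their joint evaluation maps the ultraproduct onto a subgroup B of
   a countable power of the circle. Ultraproducts along a nonprincipal
   ultrafilter are countably compact, so B is compact; the image measure is
   invariant and, B being second countable, regular. The function takes equal
   values on points with equal images, hence factors through B.

   Conversely, the Borel sets of a second countable compact abelian group B are
   generated by characters as soon as the characters separate points. To find a
   character nontrivial at x0, take a maximizing sequence v_n, with |v_n|_2 = 1,
   of a strictly convex quadratic form of the smoothed autocorrelation
   q_v = k * p_v, where p_v(x) = \int v(x + y) conj(v(y)) dy. Twisting v into
   v +- c v(s + .) decomposes 4 q_v as a sum of two competitors, so that strict
   convexity gives q(x + s) = chi(s) q(x) in the limit, with chi = lim p_(v_n).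

   For a factorization f = h o phi, pulling back along phi embeds the dual of B
   into that of the ultraproduct and carries the Fourier transform of h to that
   of f. The latter vanishes elsewhere: a character nontrivial on ker phi has
   integral 0 against h o phi by translation invariance, and one trivial on
   ker phi descends to B by countable compactness. *)
Require Import Defs.
From HB Require Import structures.
From mathcomp Require Import all_boot all_order all_algebra.
From mathcomp Require Import generic_quotient ring_quotient complex.
From mathcomp Require Import all_classical all_reals all_analysis.
From mathcomp Require Import measurable_realfun ring lra.

Set Implicit Arguments.
Unset Strict Implicit.
Unset Printing Implicit Defensive.

Import Order.TTheory GRing.Theory Num.Theory.
Import numFieldTopology.Exports numFieldNormedType.Exports.

Local Open Scope classical_set_scope.
Local Open Scope ring_scope.

(** * Bounded complex functions and their integrals *)

Section BoundedMeasurable.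
Context {R : realType} d {T : measurableType d}.
Implicit Types f g : T -> C R.

Definition bmeas f :=
  [/\ measurable_fun setT (fun x => complex.Re (f x)),
      measurable_fun setT (fun x => complex.Im (f x)) &
      exists M : C R, forall x, `|f x| <= M].

Lemma bmeas_cst (c : C R) : bmeas (fun=> c).
Proof. by split; [exact: measurable_cst..|exists `|c|]. Qed.

Lemma bmeasD f g : bmeas f -> bmeas g -> bmeas (fun x => f x + g x).
Proof.
move=> [fr fi [M fM]] [gr gi [N gN]]; split; last first.
- by exists (M + N) => x; rewrite (le_trans (ler_normD _ _))// lerD.
- rewrite (_ : (fun _ => _) = (fun x => complex.Im (f x) + complex.Im (g x))).
    exact: measurable_funD.
  by apply/funext => x; case: (f x) (g x) => [a b] [].
- rewrite (_ : (fun _ => _) = (fun x => complex.Re (f x) + complex.Re (g x))).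
    exact: measurable_funD.
  by apply/funext => x; case: (f x) (g x) => [a b] [].
Qed.

Lemma bmeasM f g : bmeas f -> bmeas g -> bmeas (fun x => f x * g x).
Proof.
move=> [fr fi [M fM]] [gr gi [N gN]]; split; last first.
- by exists (M * N) => x; rewrite normrM ler_pM.
- rewrite (_ : (fun _ => _) = (fun x => complex.Re (f x) * complex.Im (g x) +
    complex.Im (f x) * complex.Re (g x))).
    by apply: measurable_funD; exact: measurable_funM.
  by apply/funext => x; case: (f x) (g x) => [a b] [].
- rewrite (_ : (fun _ => _) = (fun x => complex.Re (f x) * complex.Re (g x) -
    complex.Im (f x) * complex.Im (g x))).
    by apply: measurable_funB; exact: measurable_funM.
  by apply/funext => x; case: (f x) (g x) => [a b] [].
Qed.

Lemma bmeasJ f : bmeas f -> bmeas (fun x => (f x)^*).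
Proof.
move=> [fr fi [M fM]]; split; last by exists M => x; rewrite norm_conjC.
- by move: fr; congr measurable_fun; apply/funext => x; case: (f x).
- rewrite (_ : (fun _ => _) = (fun x => - complex.Im (f x))).
    exact: measurableT_comp.
  by apply/funext => x; case: (f x).
Qed.

Lemma bmeasN f : bmeas f -> bmeas (fun x => - f x).
Proof.
move=> bf; have := bmeasM (bmeas_cst (-1)) bf.
by congr bmeas; apply/funext => x; rewrite mulN1r.
Qed.

Lemma bmeasB f g : bmeas f -> bmeas g -> bmeas (fun x => f x - g x).
Proof. by move=> bf bg; exact: (bmeasD bf (bmeasN bg)). Qed.

Lemma bmeas_sqr f : bmeas f -> bmeas (fun x => `|f x| ^+ 2).
Proof.
move=> bf; have := bmeasM bf (bmeasJ bf).
by congr bmeas; apply/funext => x; rewrite normCK.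
Qed.

End BoundedMeasurable.

Section ComplexIntegral.
Context {R : realType} d {T : measurableType d} (m : probability T R).
Implicit Types f g : T -> C R.
Local Notation I := (Cintegral m).

Lemma bounded_integrable (h : T -> R) (M : R) : measurable_fun setT h ->
  (forall x, `|h x| <= M) -> m.-integrable setT (EFin \o h).
Proof.
move=> mh hM; apply: measurable_bounded_integrable => //.
  exact: le_lt_trans (probability_le1 _ measurableT) (ltry _).
exists M; split; first exact: num_real.
by move=> N MN x _; exact: le_trans (hM x) (ltW MN).
Qed.

Lemma normc_Re (z : C R) : `|complex.Re z| <= Normc.normc z.
Proof.
by case: z => a b /=; rewrite -sqrtr_sqr ler_wsqrtr// lerDl sqr_ge0.
Qed.

Lemma normc_Im (z : C R) : `|complex.Im z| <= Normc.normc z.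
Proof.
by case: z => a b /=; rewrite -[leLHS]sqrtr_sqr ler_wsqrtr// lerDr sqr_ge0.
Qed.

Lemma ler_normc (z w : C R) : `|z| <= w -> Normc.normc z <= complex.Re w.
Proof. by case: w => a b; rewrite normc_def lecE /= => /andP[_]; case: z. Qed.

Lemma bmeas_integrable f : bmeas f ->
  m.-integrable setT (EFin \o (fun x => complex.Re (f x))) /\
  m.-integrable setT (EFin \o (fun x => complex.Im (f x))).
Proof.
move=> [fr fi [M fM]]; split.
  apply: (@bounded_integrable _ (complex.Re M)) => // x.
  by rewrite (le_trans (normc_Re _))// ler_normc.
apply: (@bounded_integrable _ (complex.Re M)) => // x.
by rewrite (le_trans (normc_Im _))// ler_normc.
Qed.

Lemma CintegralD f g : bmeas f -> bmeas g ->
  I (fun x => f x + g x) = I f + I g.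
Proof.
move=> /bmeas_integrable[fr fi] /bmeas_integrable[gr gi].
apply/eqP; rewrite eq_complex /=; apply/andP; split; apply/eqP.
  rewrite -RintegralD//; apply: eq_Rintegral => x _.
  by case: (f x) (g x) => [a b] [].
rewrite -RintegralD//; apply: eq_Rintegral => x _.
by case: (f x) (g x) => [a b] [].
Qed.

Lemma CintegralZ (c : C R) f : bmeas f -> I (fun x => c * f x) = c * I f.
Proof.
move=> /bmeas_integrable[fr fi]; case: c => a b.
have E (u v : R) (p q : T -> R) :
    m.-integrable setT (EFin \o p) -> m.-integrable setT (EFin \o q) ->
    \int[m]_x (u * p x + v * q x) = u * \int[m]_x p x + v * \int[m]_x q x.
  move=> ip iq; rewrite RintegralD ?RintegralZl//.
    exact: (integrableZl measurableT u ip).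
  exact: (integrableZl measurableT v iq).
apply/eqP; rewrite eq_complex /=; apply/andP; split; apply/eqP.
  rewrite -mulNr -E//; apply: eq_Rintegral => x _.
  by case: (f x) => [? ?] /=; rewrite mulNr.
by rewrite -E//; apply: eq_Rintegral => x _; case: (f x).
Qed.

Lemma CintegralN f : bmeas f -> I (fun x => - f x) = - I f.
Proof.
move=> bf; rewrite -mulN1r -CintegralZ//.
by congr Cintegral; apply/funext => x; rewrite mulN1r.
Qed.

Lemma CintegralB f g : bmeas f -> bmeas g ->
  I (fun x => f x - g x) = I f - I g.
Proof. by move=> bf bg; rewrite CintegralD ?CintegralN//; exact: bmeasN. Qed.

Lemma CintegralJ f : bmeas f -> I (fun x => (f x)^*) = (I f)^*.
Proof.
move=> /bmeas_integrable[fr fi].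
apply/eqP; rewrite eq_complex /=; apply/andP; split; apply/eqP.
  by apply: eq_Rintegral => x _; case: (f x).
rewrite -mulN1r -RintegralZl//; apply: eq_Rintegral => x _.
by case: (f x) => ? ? /=; rewrite mulN1r.
Qed.

Lemma Cintegral_cst (c : C R) : I (fun=> c) = c.
Proof.
apply/eqP; rewrite eq_complex /= !Rintegral_cst//.
by rewrite [X in fine X]probability_setT /= !mulr1 !eqxx.
Qed.

Lemma Cintegral_ge0 f : (forall x, 0 <= f x) -> 0 <= I f.
Proof.
move=> f0; rewrite lecE /= Rintegral_ge0 ?andbT; last first.
  by move=> x _; have := f0 x; rewrite lecE => /andP[].
rewrite (_ : Rintegral m setT _ = \int[m]_x (0 : R)).
  by rewrite Rintegral_cst ?mul0r.
by apply: eq_Rintegral => x _; have := f0 x; rewrite lecE /= => /andP[/eqP].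
Qed.

Lemma le_Cintegral f g : bmeas f -> bmeas g -> (forall x, f x <= g x) ->
  I f <= I g.
Proof.
move=> bf bg fg; rewrite -subr_ge0 -CintegralB//; apply: Cintegral_ge0 => x.
by rewrite subr_ge0.
Qed.

Lemma le_norm_Cintegral f g : bmeas f -> bmeas g ->
  (forall x, `|f x| <= g x) -> `|I f| <= I g.
Proof.
move=> bf bg fg; have Ig0 : 0 <= I g.
  by apply: Cintegral_ge0 => x; apply: le_trans (fg x).
have [->|If0] := eqVneq (I f) 0; first by rewrite normr0.
pose c := (I f)^* / `|I f|.
have c1 : `|c| = 1.
  by rewrite /c normrM normfV norm_conjC normr_id divff// normr_eq0.
have -> : `|I f| = I (fun x => c * f x).
  rewrite CintegralZ// /c -mulrAC [_^* * _]mulrC -normCK expr2 mulfK//.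
  by rewrite normr_eq0.
set u := (fun x => c * f x); have bu : bmeas u by exact/bmeasM/bf/bmeas_cst.
have Iu : (I u)^* = I u.
  rewrite /u CintegralZ// /c -mulrAC [_^* * _]mulrC -normCK expr2 mulfK//.
    by rewrite conj_Creal// normr_real.
  by rewrite normr_eq0.
have -> : I u = I (fun x => (u x + (u x)^*) / 2).
  rewrite (_ : (fun x => _ / 2) = (fun x => 2^-1 * (u x + (u x)^*))).
    rewrite (CintegralZ _ (bmeasD bu (bmeasJ bu))) (CintegralD bu (bmeasJ bu)).
    by rewrite CintegralJ// Iu; field.
  by apply/funext => x; rewrite mulrC.
apply: le_Cintegral => // [|x].
  by apply: bmeasM; [apply: bmeasD => //; exact: bmeasJ|exact: bmeas_cst].
apply: le_trans (fg x).
rewrite -(_ : 'Re (u x) = (u x + (u x)^*) / 2); last by rewrite ReE.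
rewrite (le_trans (real_ler_norm _)) ?Creal_Re//.
by rewrite (le_trans (leif_normC_Re_Creal _))// normrM c1 mul1r.
Qed.

Lemma norm_Cintegral_le f (M : C R) : bmeas f -> (forall x, `|f x| <= M) ->
  `|I f| <= M.
Proof.
move=> bf fM; rewrite -(Cintegral_cst M).
exact: le_norm_Cintegral bf (bmeas_cst M) fM.
Qed.

End ComplexIntegral.

Section ComplexMeasurability.
Context {R : realType}.

Lemma gt0_Re (e : C R) : 0 < e -> exists2 r : R, 0 < r & e = r%:C%C.
Proof.
by case: e => a b; rewrite ltcE /= => /andP[/eqP-> a0]; exists a.
Qed.

Lemma open_Re (U : set R) : open U -> open [set z : C R | U (complex.Re z)].
Proof.
rewrite !openE => oU z /= /oU /nbhs_ballP[e /= e0 eU].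
apply/nbhs_ballP; exists e%:C%C => /=; first by rewrite ltcR.
move=> w; rewrite /ball /= => zw; apply: eU; rewrite /ball /=.
move: zw; rewrite normc_def ltcR => /le_lt_trans; apply.
by case: z w => [a b] [a' b'] /=; rewrite -sqrtr_sqr ler_wsqrtr// lerDl sqr_ge0.
Qed.

Lemma open_Im (U : set R) : open U -> open [set z : C R | U (complex.Im z)].
Proof.
rewrite !openE => oU z /= /oU /nbhs_ballP[e /= e0 eU].
apply/nbhs_ballP; exists e%:C%C => /=; first by rewrite ltcR.
move=> w; rewrite /ball /= => zw; apply: eU; rewrite /ball /=.
move: zw; rewrite normc_def ltcR => /le_lt_trans; apply.
by case: z w => [a b] [a' b'] /=; rewrite -[leLHS]sqrtr_sqr ler_wsqrtr// lerDr sqr_ge0.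
Qed.

Lemma normc_triangle (z w : C R) :
  Normc.normc (z + w) <= Normc.normc z + Normc.normc w.
Proof.
by rewrite -lecR rmorphD /=; have := ler_normD z w; rewrite !normc_def; case: z w => [a b] [].
Qed.

Lemma Re_sqr_normC (z : C R) :
  complex.Re (`|z| ^+ 2) = complex.Re z ^+ 2 + complex.Im z ^+ 2.
Proof.
by case: z => a b; rewrite normc_def -rmorphXn /= sqr_sqrtr// addr_ge0 ?sqr_ge0.
Qed.

Lemma open_normc_gt (M : R) : open [set z : C R | M < Normc.normc z].
Proof.
rewrite openE => z /= zM; apply/nbhs_ballP.
exists ((Normc.normc z - M)%:C%C : C R); first by rewrite /= ltcR subr_gt0.
move=> w; rewrite /ball /= normc_def ltcR => zw.
have : Normc.normc z <= Normc.normc (z - w) + Normc.normc w.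
  by rewrite -{1}(subrK w z) normc_triangle.
have : Normc.normc (z - w) < Normc.normc z - M by case: (z - w) zw.
lra.
Qed.

Context d {T : measurableType d}.
Implicit Types f g : T -> C R.

Lemma measurable_borelC f : measurable_fun setT (f : T -> borelC R) <->
  forall U : set (C R), open U -> measurable (f @^-1` U).
Proof.
split=> [mf U oU|mf].
  by rewrite -[X in measurable X]setTI; apply: mf => //; exact: sub_sigma_algebra.
apply: (@measurability _ _ T (borelC R) setT f (@open (C R))) => //.
by move=> _ [U oU <-]; rewrite setTI; exact: mf.
Qed.

Lemma bmeas_open f (M : C R) : (forall U, open U -> measurable (f @^-1` U)) ->
  (forall x, `|f x| <= M) -> bmeas f.
Proof.
move=> mf fM; split; last by exists M.
  apply: (measurability _ (RGenOpens.measurableE R)) => _ [_ [a [b ->]] <-].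
  by rewrite setTI; exact: (mf _ (open_Re (interval_open _ _))).
apply: (measurability _ (RGenOpens.measurableE R)) => _ [_ [a [b ->]] <-].
by rewrite setTI; exact: (mf _ (open_Im (interval_open _ _))).
Qed.

End ComplexMeasurability.

Section ComplexIntegralAE.
Context {R : realType} d {T : measurableType d} (m : probability T R).
Implicit Types f g : T -> C R.

Lemma ae_eq_Rintegral (f g : T -> R) : measurable_fun setT f ->
  measurable_fun setT g -> {ae m, forall x, f x = g x} ->
  \int[m]_x f x = \int[m]_x g x.
Proof.
move=> mf mg fg; congr fine; apply: ae_eq_integral => //.
- exact/measurable_EFinP.
- exact/measurable_EFinP.
- by apply: filterS fg => x -> _.
Qed.

Lemma measurable_ReIm f : measurable_fun setT (f : T -> borelC R) ->
  measurable_fun setT (fun x => complex.Re (f x)) /\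
  measurable_fun setT (fun x => complex.Im (f x)).
Proof.
move=> /measurable_borelC mf.
split; apply: (measurability _ (RGenOpens.measurableE R)) => _ [_ [a [b ->]] <-].
  by rewrite setTI; exact: (mf _ (open_Re (interval_open _ _))).
by rewrite setTI; exact: (mf _ (open_Im (interval_open _ _))).
Qed.

Lemma measurable_ReImM f g : measurable_fun setT (fun x => complex.Re (f x)) ->
  measurable_fun setT (fun x => complex.Im (f x)) -> bmeas g ->
  measurable_fun setT (fun x => complex.Re (f x * g x)) /\
  measurable_fun setT (fun x => complex.Im (f x * g x)).
Proof.
move=> fr fi [gr gi _]; split.
  rewrite (_ : (fun _ => _) = (fun x => complex.Re (f x) * complex.Re (g x) -
    complex.Im (f x) * complex.Im (g x))).
    by apply: measurable_funB; exact: measurable_funM.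
  by apply/funext => x; case: (f x) (g x) => [a b] [].
rewrite (_ : (fun _ => _) = (fun x => complex.Re (f x) * complex.Im (g x) +
  complex.Im (f x) * complex.Re (g x))).
  by apply: measurable_funD; exact: measurable_funM.
by apply/funext => x; case: (f x) (g x) => [a b] [].
Qed.

Lemma ae_eq_Cintegral f g (u : T -> C R) :
  measurable_fun setT (f : T -> borelC R) ->
  measurable_fun setT (g : T -> borelC R) -> bmeas u ->
  {ae m, forall x, f x = g x} ->
  Cintegral m (fun x => f x * u x) = Cintegral m (fun x => g x * u x).
Proof.
move=> /measurable_ReIm[fr fi] /measurable_ReIm[gr gi] bu fg.
have [pr pi] := measurable_ReImM fr fi bu.
have [qr qi] := measurable_ReImM gr gi bu.
congr Complex; apply: ae_eq_Rintegral => //.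
  by apply: filterS fg => x ->.
by apply: filterS fg => x ->.
Qed.

Lemma Cintegral_sqr_eq0 f : bmeas f ->
  Cintegral m (fun x => `|f x| ^+ 2) = 0 -> {ae m, forall x, f x = 0}.
Proof.
move=> /bmeas_sqr bf I0; have [ir _] := bmeas_integrable m bf.
have [mr _ _] := bf.
have : (\int[m]_x `|(complex.Re (`|f x| ^+ 2))%:E| = 0)%E.
  have : Rintegral m setT (fun x => complex.Re (`|f x| ^+ 2)) = 0.
    by move: I0 => /(congr1 (@complex.Re R)).
  rewrite /Rintegral => I0r; have {I0r} := congr1 (@EFin R) I0r.
  rewrite fineK; last exact: integrable_fin_num.
  move=> I0r; apply: etrans I0r; apply: eq_integral => x _; rewrite /= ger0_norm//.
  by rewrite mulr0 subr0 -expr2 sqr_ge0.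
move=> /ae_eq_integral_abs => /(_ measurableT); case.
  exact/measurable_EFinP.
move=> N [mN N0 sN]; exists N; split=> // x /= fx; apply: sN => fx0; apply: fx.
have : complex.Re (`|f x| ^+ 2) = 0 := congr1 fine (fx0 I).
rewrite Re_sqr_normC => ab0.
have : complex.Re (f x) ^+ 2 = 0 /\ complex.Im (f x) ^+ 2 = 0.
  have := sqr_ge0 (complex.Re (f x)); have := sqr_ge0 (complex.Im (f x)); lra.
move=> [/eqP + /eqP]; rewrite !sqrf_eq0.
by case: (f x) => a b /= /eqP-> /eqP->.
Qed.

End ComplexIntegralAE.

Section ComplexIntegralTransfer.
Context {R : realType} d1 d2 {T1 : measurableType d1} {T2 : measurableType d2}.
Context (m1 : probability T1 R) (m2 : probability T2 R) (phi : T1 -> T2).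
Hypothesis mphi : measurable_fun setT phi.
Hypothesis phi_pres : forall S, measurable S -> m1 (phi @^-1` S) = m2 S.

Lemma bmeas_comp (g : T2 -> C R) : bmeas g -> bmeas (g \o phi).
Proof.
move=> [gr gi [M gM]]; split; last by exists M => x; exact: gM.
- exact: (measurableT_comp gr mphi).
- exact: (measurableT_comp gi mphi).
Qed.

Lemma Rintegral_comp (g : T2 -> R) : measurable_fun setT g ->
  m1.-integrable setT (EFin \o (g \o phi)) ->
  \int[m1]_x g (phi x) = \int[m2]_x g x.
Proof.
move=> mg ig; congr fine.
transitivity (\int[pushforward m1 phi]_y (g y)%:E)%E.
  rewrite (integral_pushforward mphi)//; exact/measurable_EFinP.
by apply: eq_measure_integral => A mA _; exact: phi_pres.
Qed.

Lemma Cintegral_comp (g : T2 -> C R) : bmeas g ->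
  Cintegral m1 (fun x => g (phi x)) = Cintegral m2 g.
Proof.
move=> bg; have [ir ii] := bmeas_integrable m1 (bmeas_comp bg).
by case: bg => gr gi _; congr Complex; apply: Rintegral_comp.
Qed.

End ComplexIntegralTransfer.

(** * Limits and uniform continuity *)

Section BoundedLimits.
Context {R : realType}.

Lemma C_hausdorff : hausdorff_space (C R).
Proof. exact: (@norm_hausdorff (C R) (C R)). Qed.

Lemma Complex_continuous : continuous (fun x : R * R => Complex x.1 x.2 : C R).
Proof.
move=> [a b] U /= /nbhs_ballP[e /= e0 eU].
have [r r0 eE] := gt0_Re e0; rewrite {}eE in eU.
have d0 : 0 < r / 2 by rewrite divr_gt0.
exists (ball a (r / 2), ball b (r / 2)) => /=.
  by split; exact: nbhsx_ballx.
move=> [c d] /= [ac bd]; apply: eU; rewrite /ball /=.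
have -> : Complex a b - Complex c d =
    (a - c)%:C%C + 'i%C * (b - d)%:C%C by rewrite [LHS]complexE.
apply: (le_lt_trans (ler_normD _ _)).
rewrite normrM !normc_def /= !expr0n !expr1n /= !addr0 add0r !sqrtr_sqr sqrtr1.
rewrite mul1r -rmorphD ltcR [r]splitr ltrD//.
Qed.

Lemma fmap_ultra (S T : Type) (G : set_system S) (u : S -> T) :
  UltraFilter G -> UltraFilter (u @ G).
Proof.
move=> GU; split; first exact: fmap_proper_filter.
move=> H PH uGH; apply/seteqP; split=> // V HV.
have [//|GV] := in_ultra_setVsetC (u @^-1` V) GU.
have /filter_ex[x [//]] : H (V `&` ~` V) by apply: filterI => //; exact: uGH.
Qed.

Lemma bounded_ultra_cvg (I : Type) (G : set_system I) (u : I -> C R) (M : C R) :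
  UltraFilter G -> (forall i, `|u i| <= M) -> exists l : C R, u @ G --> l.
Proof.
move=> GU uM; pose K : set (C R) :=
  (fun x : R * R => Complex x.1 x.2 : C R) @`
    (`[- complex.Re M, complex.Re M] `*` `[- complex.Re M, complex.Re M]).
have cK : compact K.
  apply: continuous_compact.
    by apply/continuous_subspaceT => x; exact: Complex_continuous.
  by apply: compact_setX; exact: segment_compact.
move: cK; rewrite compact_ultra => /(_ (u @ G)) [||l [_ ul]].
- exact: fmap_ultra GU.
- have : \forall i \near G, K (u i); last by [].
  apply: nearW => i; exists (complex.Re (u i), complex.Im (u i)) => /=; last by case: (u i).
  have := ler_normc (uM i); split; rewrite /= in_itv/= -ler_norml.
    exact: le_trans (normc_Re _) _.
  exact: le_trans (normc_Im _) _.
- by exists l.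
Qed.

Lemma bounded_ultra_cvg_fun (X I : Type) (G : set_system I) (u : X -> I -> C R)
    (M : C R) : UltraFilter G -> (forall x i, `|u x i| <= M) ->
  exists l : X -> C R, forall x, u x @ G --> l x.
Proof.
move=> GU uM; suff [l ul] : {l : X -> C R & forall x, u x @ G --> l x} by exists l.
by apply: (@choice _ _ (fun x l => u x @ G --> l)) => x; exact: bounded_ultra_cvg.
Qed.

Lemma cvg_conjC (I : Type) (G : set_system I) (u : I -> C R) (l : C R) :
  Filter G -> u @ G --> l -> (fun i => (u i)^*) @ G --> l^*.
Proof.
move=> FG ul; suff cJ : continuous (fun z : C R => z^* : C R).
  exact: (@cvg_comp _ _ _ u (fun z : C R => z^* : C R) _ _ _ ul (cJ l)).
by  apply/continuousP => U; exact: open_conjC.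
Qed.

End BoundedLimits.

Section CompactGroup.
Context {R : realType} {B : topologicalZmodType}.
Hypothesis cB : compact_group B.
Implicit Types f g : B -> C R.

Lemma continuous_addl (a : B) : continuous (fun y => a + y).
Proof.
move=> y; apply: (@continuous_comp _ _ _ (fun y => (a, y)) (fun x => x.1 + x.2)).
  by apply: cvg_pair => /=; [exact: cvg_cst|exact: cvg_id].
exact: add_continuous.
Qed.

Lemma continuous_subl (a : B) : continuous (fun y => a - y).
Proof.
move=> y; apply: (@continuous_comp _ _ _ (fun y => (a, y)) (fun x => x.1 - x.2)).
  by apply: cvg_pair => /=; [exact: cvg_cst|exact: cvg_id].
exact: sub_continuous.
Qed.

Lemma near_continuous f (x : B) (e : C R) : continuous f -> 0 < e ->
  \forall z \near x, `|f x - f z| < e.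
Proof.
by move=> cf e0; have /cvgrPdist_lt := cf x; exact.
Qed.

Lemma continuous_bounded f : continuous f -> exists M : C R, forall x, `|f x| <= M.
Proof.
move=> cf; have [+ _] := cB; rewrite compact_near_coveringP.
move=> /(_ R (pinfty_nbhs R) (fun M x => Normc.normc (f x) < M)) [].
  move=> x _; exists ([set x' | `|f x - f x'| < 1],
      [set M | Normc.normc (f x) + 1 < M]) => /=.
    split; first exact: near_continuous cf ltr01.
    by apply: nbhs_pinfty_gt; rewrite num_real.
  move=> [x' M] /= [fxx' xM]; apply: le_lt_trans xM.
  move: fxx'; rewrite distrC normc_def -[1]/(1%:C%C) ltcR => fxx'.
  rewrite -{1}(subrK (f x) (f x')) addrC (le_trans (normc_triangle _ _))//.
  by rewrite lerD2l ltW//; case: (f x' - f x) fxx'.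
move=> M0 [_ /(_ (M0 + 1))]; rewrite ltrDl ltr01 => /(_ isT) fM.
by exists (M0 + 1)%:C%C => x; have := fM x I; rewrite -ltcR => /ltW.
Qed.

Lemma bmeas_continuous f : continuous f -> bmeas (f : borel B -> C R).
Proof.
move=> cf; have [M fM] := continuous_bounded cf.
apply: (@bmeas_open R _ (borel B) f M) => // U oU; apply: sub_sigma_algebra.
by move/continuousP : cf; exact.
Qed.

Lemma unif_continuous f (e : C R) : continuous f -> 0 < e ->
  \forall h \near (0 : B), forall y, `|f (y + h) - f y| < e.
Proof.
move=> cf e0; have [+ _] := cB; rewrite compact_near_coveringP.
move=> /(_ B (nbhs 0) (fun h y => `|f (y + h) - f y| < e)) H.
have {H} : \forall h \near (0 : B), [set: B] `<=` (fun y => `|f (y + h) - f y| < e).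
  apply: H => y _.
  have e20 : 0 < e / 2 by rewrite divr_gt0.
  have c1 : \forall z \near (y, (0 : B)), `|f y - f (z.1 + z.2)| < e / 2.
    have nb : nbhs (y + 0) [set z | `|f y - f z| < e / 2].
      by rewrite addr0; exact: near_continuous cf e20.
    exact: (@add_continuous B (y, 0) _ nb).
  have c2 := near_continuous y cf e20.
  case: c1 => -[U V] /= [Uy V0] UV; exists (U `&` [set z | `|f y - f z| < e / 2], V) => /=.
    by split => //; exact: filterI.
  move=> [y' h] /= [[Uy' yy'] Vh].
  rewrite -(subrK (f y) (f (y' + h))) -addrA.
  rewrite (le_lt_trans (ler_normD _ _))// (splitr e) ltrD// distrC.
  exact: (UV (y', h)).
by apply: filterS => h H y; exact: H.
Qed.

End CompactGroup.

(** * Autocorrelations on a compact group *)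

Definition translation_invariant (R : realType) (G : zmodType)
    (S : set (set G)) (m : probability (gen_sigma G S) R) :=
  forall (a : G) (E : set (gen_sigma G S)), measurable E ->
    measurable ((fun x : G => a + x) @^-1` E : set (gen_sigma G S)) /\
    m ((fun x : G => a + x) @^-1` E) = m E.

Section TranslationInvariance.
Context {R : realType} {G : zmodType} {S : set (set G)}.
Context (m : probability (gen_sigma G S) R).
Hypothesis minv : translation_invariant m.

Lemma measurable_addl (a : G) :
  measurable_fun setT ((fun x : G => a + x) : gen_sigma G S -> gen_sigma G S).
Proof. by move=> _ E mE; rewrite setTI; exact: (minv a mE).1. Qed.

Lemma Cintegral_addl (a : G) (f : gen_sigma G S -> C R) : bmeas f ->
  Cintegral m (fun x : G => f (a + x)) = Cintegral m f.
Proof.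
apply: (Cintegral_comp (measurable_addl a)) => E mE; exact: (minv a mE).2.
Qed.

End TranslationInvariance.

Section HaarIntegral.
Context {R : realType} {B : topologicalZmodType}.
Hypothesis cB : compact_group B.
Context (m : probability (borel B) R).
Hypothesis minv : translation_invariant m.
Implicit Types f g v p k : B -> C R.

Local Notation I f := (Cintegral m (f : borel B -> C R)).
Local Notation bm f := (bmeas (f : borel B -> C R)).

Lemma open_not_negligible (U : set B) : open U -> U !=set0 ->
  ~ m.-negligible (U : set (borel B)).
Proof.
move=> oU [x0 Ux0] nU.
have [+ _] := cB; rewrite compact_near_coveringP.
move=> /(_ (borel B) (almost_everywhere m) (fun i x => i <> x :> B)) [].
  move=> x _; pose V := (fun y => (x0 - x) + y) @^-1` U.
  have mU : measurable (U : set (borel B)) by exact: sub_sigma_algebra.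
  have [mV mVU] := minv (x0 - x) mU.
  exists (V, ~` V) => /=; last by move=> [x' i] /= [Vx' Vi] ix; apply: Vi; rewrite ix.
  split; last first.
    exists V; split; first exact: mV.
      have := measure_negligible mU nU; by rewrite mVU.
    by move=> y /= /contrapT.
  apply: open_nbhs_nbhs; split; last by rewrite /V /= subrK.
  exact: (open_comp (fun y _ => @continuous_addl B (x0 - x) y) oU).
move=> N [mN N0 sN]; suff : m setT = 0.
  by rewrite probability_setT => /eqP; rewrite onee_eq0.
apply/eqP; rewrite eq_le measure_ge0 andbT -N0 le_measure ?inE//.
by move=> i _; apply: sN => /= /(_ i Logic.I).
Qed.

Lemma Cintegral_sqr_eq0_continuous f : continuous f ->
  I (fun x => `|f x| ^+ 2) = 0 -> forall x, f x = 0.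
Proof.
move=> cf f0 x; apply: contrapT => fx.
have [N [mN N0 sN]] := Cintegral_sqr_eq0 (bmeas_continuous cB cf) f0.
apply: (@open_not_negligible (f @^-1` (~` [set 0]))).
- move/continuousP : cf; apply; rewrite openC.
  by apply: accessible_closed_set1; apply: hausdorff_accessible; exact: C_hausdorff.
- by exists x.
- by exists N; split=> // y fy; exact: sN.
Qed.

Lemma continuous_shift f (a : B) : continuous f -> continuous (fun y => f (a + y)).
Proof.
by move=> cf y; apply: (@continuous_comp _ _ _ (fun y => a + y) f);
  [exact: continuous_addl|exact: cf].
Qed.

Lemma continuous_rev f (a : B) : continuous f -> continuous (fun y => f (a - y)).
Proof.
by move=> cf y; apply: (@continuous_comp _ _ _ (fun y => a - y) f);
  [exact: continuous_subl|exact: cf].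
Qed.

Lemma continuousMC f g : continuous f -> continuous g ->
  continuous (fun y => f y * g y : C R).
Proof. by move=> cf cg y; exact: (cvgM (cf y) (cg y)). Qed.

Lemma continuousDC f g : continuous f -> continuous g ->
  continuous (fun y => f y + g y : C R).
Proof. by move=> cf cg y; exact: (cvgD (cf y) (cg y)). Qed.

Lemma unif_continuous_continuous f :
  (forall e : C R, 0 < e ->
     \forall h \near (0 : B), forall x, `|f (x + h) - f x| <= e) ->
  continuous f.
Proof.
move=> uf x; apply/cvgrPdist_lt => e e0.
have e20 : 0 < e / 2 by rewrite divr_gt0.
have nx : nbhs (- x + x) [set h | forall z, `|f (z + h) - f z| <= e / 2].
  by rewrite addNr; exact: uf.
have : \forall y \near x, forall z, `|f (z + (- x + y)) - f z| <= e / 2.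
  exact: (@continuous_addl B (- x) x _ nx).
apply: filterS => y /(_ x).
rewrite addrA subrr add0r distrC => fyx.
by rewrite (le_lt_trans fyx)// ltr_pdivrMr// ltr_pMr// ltr1n.
Qed.

Definition acorr v (x : B) : C R := I (fun y => v (x + y) * (v y)^*).
Definition conv k p (x : B) : C R := I (fun y => k (x - y) * p y).

Lemma bmeas_acorr v (x z : B) : continuous v ->
  bm (fun y => v (x + y) * (v (z + y))^*).
Proof.
move=> cv; apply: bmeasM; first exact/bmeas_continuous/continuous_shift.
exact/bmeasJ/bmeas_continuous/continuous_shift.
Qed.

Lemma bmeas_acorr0 v (x : B) : continuous v -> bm (fun y => v (x + y) * (v y)^*).
Proof.
move=> cv; apply: bmeasM; first exact/bmeas_continuous/continuous_shift.
exact/bmeasJ/bmeas_continuous.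
Qed.

Lemma acorr_shift v (x z : B) : continuous v ->
  I (fun y => v (x + y) * (v (z + y))^*) = acorr v (x - z).
Proof.
move=> cv; rewrite -(Cintegral_addl minv (- z)); last exact: bmeas_acorr.
congr Cintegral; apply/funext => y; rewrite !addrA subrr add0r.
by congr (v (_ + _) * _).
Qed.

Lemma acorr0 v : acorr v 0 = I (fun y => `|v y| ^+ 2).
Proof. by congr Cintegral; apply/funext => y; rewrite add0r normCK. Qed.

Lemma acorr0_ge0 v : 0 <= acorr v 0.
Proof. by rewrite acorr0; apply: Cintegral_ge0 => y; rewrite exprn_ge0. Qed.

Lemma bmeas_sqr_continuous f : continuous f -> bm (fun y => `|f y| ^+ 2).
Proof. by move=> cf; exact/bmeas_sqr/bmeas_continuous. Qed.

Lemma norm_acorr_le v (x : B) : continuous v -> `|acorr v x| <= acorr v 0.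
Proof.
move=> cv; have cvx := @continuous_shift v x cv.
have -> : acorr v 0 = I (fun y => 2^-1 * (`|v (x + y)| ^+ 2 + `|v y| ^+ 2)).
  rewrite CintegralZ; last by apply: bmeasD; exact: bmeas_sqr_continuous.
  rewrite CintegralD; [|exact: bmeas_sqr_continuous..].
  rewrite (Cintegral_addl minv x (bmeas_sqr_continuous cv)) -acorr0.
  by field.
apply: le_norm_Cintegral => [||y].
- exact: (@bmeas_acorr0 v x cv).
- by apply: bmeasM; [exact: bmeas_cst|apply: bmeasD; exact: bmeas_sqr_continuous].
rewrite normrM norm_conjC; set a := `|v (x + y)|; set b := `|v y|.
have ab0 : 0 <= (a - b) ^+ 2.
  by rewrite real_exprn_even_ge0// rpredB// normr_real.
rewrite -subr_ge0 (_ : _ - _ = 2^-1 * (a - b) ^+ 2); last by field.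
by rewrite mulr_ge0// invr_ge0.
Qed.

Lemma acorrN v (x : B) : continuous v -> acorr v (- x) = (acorr v x)^*.
Proof.
move=> cv; rewrite -[in LHS](add0r (- x)) -acorr_shift// /acorr -CintegralJ.
  by congr Cintegral; apply/funext => y; rewrite rmorphM/= conjCK add0r mulrC.
exact: (@bmeas_acorr0 v x cv).
Qed.

Lemma acorr_scale (c : C R) v (x : B) : continuous v ->
  acorr (fun y => c * v y) x = `|c| ^+ 2 * acorr v x.
Proof.
move=> cv; rewrite /acorr -CintegralZ; last first.
  exact: (@bmeas_acorr0 v x cv).
by congr Cintegral; apply/funext => y; rewrite rmorphM/= normCK; ring.
Qed.

Lemma acorr_twist (c : C R) (s : B) v (x : B) : continuous v -> `|c| = 1 ->
  acorr (fun y => v y + c * v (s + y)) x =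
  2 * acorr v x + c * acorr v (x + s) + c^* * acorr v (x - s).
Proof.
move=> cv c1; rewrite /acorr.
have cc : c * c^* = 1 by rewrite -normCK c1 expr1n.
rewrite (_ : (fun y => _) = (fun y => (v (x + y) * (v (0 + y))^* +
   c * (v ((x + s) + y) * (v (0 + y))^*)) +
  (c^* * (v (x + y) * (v (s + y))^*) + v ((x + s) + y) * (v (s + y))^*))).
  have b1 := bmeas_acorr x 0 cv; have b2 := bmeas_acorr (x + s) 0 cv.
  have b3 := bmeas_acorr x s cv; have b4 := bmeas_acorr (x + s) s cv.
  have b2' := bmeasM (bmeas_cst c) b2; have b3' := bmeasM (bmeas_cst c^*) b3.
  rewrite (CintegralD _ (bmeasD b1 b2') (bmeasD b3' b4)).
  rewrite (CintegralD _ b1 b2') (CintegralD _ b3' b4).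
  rewrite (CintegralZ _ _ b2) (CintegralZ _ _ b3) !acorr_shift//.
  by rewrite !subr0 addrK -/(acorr v x) -/(acorr v (x + s)) -/(acorr v (x - s)); ring.
apply/funext => y; rewrite !add0r rmorphD rmorphM/= (addrC x s) -(addrA s x y).
by rewrite !mulrDl !mulrDr [c * _ * (_ * _)]mulrACA cc mul1r; ring.
Qed.

Lemma div_mul_le (e M : C R) : 0 < e -> 0 <= M -> e / (M + 1) * M <= e.
Proof.
move=> e0 M0; rewrite mulrAC ler_pdivrMr ?ltr_wpDl//.
by rewrite ler_wpM2l ?lerDl// ltW.
Qed.

Lemma acorr_continuous v : continuous v -> continuous (acorr v).
Proof.
move=> cv; apply: unif_continuous_continuous => e e0.
have [M vM] := continuous_bounded cB cv.
have M0 : 0 <= M by apply: le_trans (vM 0).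
have d0 : 0 < e / (M + 1) by rewrite divr_gt0// ltr_wpDl.
have := unif_continuous cB cv d0; apply: filterS => h hv x.
have b1 := bmeas_acorr (x + h) 0 cv; have b2 := bmeas_acorr x 0 cv.
rewrite -[X in acorr v X]subr0 -[X in _ - acorr v X]subr0 -!acorr_shift//.
rewrite -CintegralB//; apply: norm_Cintegral_le => [|y]; first exact: bmeasB.
rewrite -mulrBl normrM norm_conjC add0r -addrA (addrC h) addrA.
by rewrite (le_trans (ler_pM _ _ (ltW (hv _)) (vM y)))// div_mul_le.
Qed.

Lemma bmeas_conv k p (x : B) : continuous k -> continuous p ->
  bm (fun y => k (x - y) * p y).
Proof.
move=> ck cp; apply: bmeasM; last exact: bmeas_continuous.
exact/(bmeas_continuous cB)/continuous_rev.
Qed.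

Lemma conv_bound k p (K P : C R) : continuous k -> continuous p ->
  (forall x, `|k x| <= K) -> (forall x, `|p x| <= P) ->
  forall x, `|conv k p x| <= K * P.
Proof.
move=> ck cp kK pP x.
apply: norm_Cintegral_le => [|y]; first exact: bmeas_conv.
by rewrite normrM ler_pM.
Qed.

Lemma conv_equicontinuous k p (e P : C R) (h : B) : continuous k -> continuous p ->
  (forall y, `|k (y + h) - k y| < e) -> (forall x, `|p x| <= P) ->
  forall x, `|conv k p (x + h) - conv k p x| <= e * P.
Proof.
move=> ck cp kh pP x; rewrite /conv -CintegralB; [|exact: bmeas_conv..].
apply: norm_Cintegral_le => [|y]; first by apply: bmeasB; exact: bmeas_conv.
by rewrite -mulrBl normrM ler_pM// addrAC ltW.
Qed.

Lemma conv_continuous k p : continuous k -> continuous p -> continuous (conv k p).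
Proof.
move=> ck cp; apply: unif_continuous_continuous => e e0.
have [M vM] := continuous_bounded cB cp.
have M0 : 0 <= M by apply: le_trans (vM 0).
have d0 : 0 < e / (M + 1) by rewrite divr_gt0// ltr_wpDl.
have := unif_continuous cB ck d0; apply: filterS => h hv x.
by rewrite (le_trans (conv_equicontinuous ck cp hv vM x))// div_mul_le.
Qed.

Lemma conv_shift k p (s x : B) : continuous k -> continuous p ->
  conv k (fun y => p (y + s)) x = conv k p (x + s).
Proof.
move=> ck cp; rewrite /conv -[RHS](Cintegral_addl minv s); last exact: bmeas_conv.
congr Cintegral; apply/funext => y; rewrite [s + y]addrC.
by congr (k _ * _); rewrite opprD addrA [x + s - y]addrAC addrK.
Qed.

(* Smoothing by the fixed kernel [k] makes the family of autocorrelations with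
   value 1 at 0 equicontinuous, whence compactness. *)
Definition smooth k v : B -> C R := conv k (acorr v).

Lemma smooth_twist k (c : C R) (s : B) v (x : B) :
  continuous k -> continuous v -> `|c| = 1 ->
  smooth k (fun y => v y + c * v (s + y)) x =
  2 * smooth k v x + c * smooth k v (x + s) + c^* * smooth k v (x - s).
Proof.
move=> ck cv c1; rewrite /smooth; have cp := acorr_continuous cv.
have cps (t : B) : continuous (fun y => acorr v (y + t)).
  by under eq_fun do rewrite addrC; exact: continuous_shift.
have b1 := bmeas_conv x ck cp.
have b2 := bmeas_conv x ck (cps s); have b3 := bmeas_conv x ck (cps (- s)).
rewrite -(conv_shift s x ck cp) -(conv_shift (- s) x ck cp) /conv.
rewrite -(CintegralZ m 2 b1) -(CintegralZ m c b2) -(CintegralZ m c^* b3).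
rewrite -CintegralD; [|by apply: bmeasM; [exact: bmeas_cst|]..].
rewrite -CintegralD; last 2 first.
- by apply: bmeasD; apply: bmeasM => //; exact: bmeas_cst.
- by apply: bmeasM => //; exact: bmeas_cst.
by congr Cintegral; apply/funext => y; rewrite acorr_twist//; ring.
Qed.

Lemma smooth_scale k (c : C R) v (x : B) : continuous k -> continuous v ->
  smooth k (fun y => c * v y) x = `|c| ^+ 2 * smooth k v x.
Proof.
move=> ck cv; rewrite /smooth /conv -CintegralZ; last first.
  exact: bmeas_conv (acorr_continuous cv).
by congr Cintegral; apply/funext => y; rewrite acorr_scale//; ring.
Qed.

End HaarIntegral.

(** * Existence of characters *)

Section ExtremalCharacter.
Context {R : realType} {B : topologicalZmodType}.
Hypothesis cB : compact_group B.
Context (m : probability (borel B) R).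
Hypothesis minv : translation_invariant m.
Implicit Types q v : B -> C R.
Local Notation I f := (Cintegral m (f : borel B -> C R)).

Variables (k : B -> C R) (x0 : B) (eps K : C R).
Hypotheses (ck : continuous k) (eps0 : 0 < eps) (kK : forall x, `|k x| <= K).
Local Notation smooth := (smooth m k).
Local Notation acorr := (acorr m).

(* Maximizing the quadratic form [energy] over the smoothed autocorrelations
   forces the maximizer to be a multiple of a character: the second term makes
   it strictly convex, the first one keeps the character nontrivial at [x0]. *)
Definition energy q : C R :=
  `|q 0 - q x0| ^+ 2 + eps * I (fun x => `|q x| ^+ 2).

Lemma sqr_norm_weighted (a b z w : C R) : a^* = a -> b^* = b ->
  `|b * z - a * w| ^+ 2 =
  b * (a + b) * `|z| ^+ 2 + a * (a + b) * `|w| ^+ 2 - a * b * `|z + w| ^+ 2.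
Proof.
move=> aJ bJ; rewrite !normCK rmorphB rmorphD !rmorphM /= aJ bJ.
ring.
Qed.

Lemma parallelogram (z w : C R) :
  `|z - w| ^+ 2 + `|z + w| ^+ 2 = 2 * (`|z| ^+ 2 + `|w| ^+ 2).
Proof. by rewrite !normCK rmorphB rmorphD /=; ring. Qed.

Lemma continuousZC (c : C R) q : continuous q -> continuous (fun x => c * q x).
Proof.
move=> cq; have cc : continuous (fun _ : B => c) by move=> x; exact: cvg_cst.
exact: continuousMC cc cq.
Qed.

Lemma energy_weighted (a b : C R) q1 q2 : a^* = a -> b^* = b ->
  continuous q1 -> continuous q2 ->
  energy (fun x => b * q1 x - a * q2 x) =
  b * (a + b) * energy q1 + a * (a + b) * energy q2 -
  a * b * energy (fun x => q1 x + q2 x).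
Proof.
move=> aJ bJ cq1 cq2; rewrite /energy.
have b1 := bmeas_sqr_continuous cB cq1; have b2 := bmeas_sqr_continuous cB cq2.
have b12 := bmeas_sqr_continuous cB (continuousDC cq1 cq2).
rewrite (_ : (fun x => `|b * q1 x - a * q2 x| ^+ 2) = (fun x =>
   (b * (a + b) * `|q1 x| ^+ 2 + a * (a + b) * `|q2 x| ^+ 2) -
   a * b * `|q1 x + q2 x| ^+ 2)); last first.
  by apply/funext => x; rewrite sqr_norm_weighted.
have b1' := bmeasM (bmeas_cst (b * (a + b))) b1.
have b2' := bmeasM (bmeas_cst (a * (a + b))) b2.
have b12' := bmeasM (bmeas_cst (a * b)) b12.
rewrite (CintegralB _ (bmeasD b1' b2') b12') (CintegralD _ b1' b2').
rewrite (CintegralZ _ _ b1) (CintegralZ _ _ b2) (CintegralZ _ _ b12).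
have -> : b * q1 0 - a * q2 0 - (b * q1 x0 - a * q2 x0) =
  b * (q1 0 - q1 x0) - a * (q2 0 - q2 x0) by ring.
have -> : q1 0 + q2 0 - (q1 x0 + q2 x0) = q1 0 - q1 x0 + (q2 0 - q2 x0).
  by ring.
by rewrite sqr_norm_weighted//; ring.
Qed.

Lemma energy_scale (c : C R) q : continuous q ->
  energy (fun x => c * q x) = `|c| ^+ 2 * energy q.
Proof.
move=> cq; rewrite /energy.
have -> : c * q 0 - c * q x0 = c * (q 0 - q x0) by ring.
have -> : (fun x => `|c * q x| ^+ 2) = (fun x => `|c| ^+ 2 * `|q x| ^+ 2).
  by apply/funext => x; rewrite normrM exprMn.
rewrite (CintegralZ _ _ (bmeas_sqr_continuous cB cq)) normrM exprMn.
by ring.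
Qed.

Lemma energy_ge0 q : 0 <= energy q.
Proof.
rewrite addr_ge0 ?exprn_ge0// mulr_ge0//; first exact: ltW.
by apply: Cintegral_ge0 => x; exact: exprn_ge0.
Qed.

Lemma energy_integral q : eps * I (fun x => `|q x| ^+ 2) <= energy q.
Proof. by rewrite lerDr exprn_ge0. Qed.

Lemma energy_bound q (L : C R) : continuous q -> (forall x, `|q x| <= L) ->
  energy q <= `|q 0 - q x0| ^+ 2 + eps * L ^+ 2.
Proof.
move=> cq qL; rewrite lerD2l ler_wpM2l//; first exact: ltW.
rewrite -(Cintegral_cst m (L ^+ 2)).
apply: le_Cintegral => [||x]; first exact: bmeas_sqr_continuous.
  exact: bmeas_cst.
by rewrite lerXn2r ?nnegrE// (le_trans _ (qL x)).
Qed.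

Lemma smooth_continuous v : continuous v -> continuous (smooth v).
Proof. by move=> cv; exact: (@conv_continuous R B cB m k _ ck (acorr_continuous cB minv cv)). Qed.

Lemma smooth_bound v (x : B) : continuous v -> `|smooth v x| <= K * acorr v 0.
Proof.
move=> cv; have cp := acorr_continuous cB minv cv.
exact: (conv_bound cB m ck cp kK (fun y => norm_acorr_le cB minv y cv)).
Qed.

Lemma continuous_twist (c : C R) (s : B) v : continuous v ->
  continuous (fun y => v y + c * v (s + y)).
Proof.
by move=> cv; apply: (continuousDC cv); exact/continuousZC/continuous_shift.
Qed.

Variable M : C R.
Hypothesis energy_le :
  forall v, continuous v -> acorr v 0 = 1 -> energy (smooth v) <= M.

Lemma energy_le_sqr v : continuous v -> energy (smooth v) <= M * acorr v 0 ^+ 2.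
Proof.
move=> cv; have N0 := acorr0_ge0 m v.
have [Nz|Nnz] := eqVneq (acorr v 0) 0.
  rewrite Nz expr0n mulr0 (_ : smooth v = fun=> 0).
    rewrite /energy subrr normr0 expr0n /= add0r.
    by rewrite Cintegral_cst mulr0.
  apply/funext => x; apply/eqP; rewrite -normr_le0.
  by rewrite (le_trans (smooth_bound x cv))// Nz mulr0.
pose c := (sqrtC (acorr v 0))^-1.
have c2 : `|c| ^+ 2 = (acorr v 0)^-1.
  by rewrite /c normfV ger0_norm ?sqrtC_ge0// exprVn sqrtCK.
have := energy_le (@continuousZC c _ cv).
rewrite (acorr_scale cB m c 0 cv) c2 mulVf// => /(_ erefl).
rewrite (_ : smooth _ = fun x => (acorr v 0)^-1 * smooth v x); last first.
  by apply/funext => x; rewrite (smooth_scale cB minv c x ck cv) c2.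
rewrite (energy_scale _ (smooth_continuous cv)) normfV ger0_norm// exprVn mulrC.
by rewrite ler_pdivrMr// exprn_gt0// lt0r Nnz.
Qed.

(* The twists of [v] by [c] and by [- c] have autocorrelations adding up to four
   times that of [v], so near a maximum they are almost proportional to it. *)
Lemma energy_twist (c : C R) (s : B) v : continuous v -> acorr v 0 = 1 ->
  `|c| = 1 ->
  energy (fun x => c * smooth v (x + s) + c^* * smooth v (x - s) -
                   (c * acorr v s + c^* * acorr v (- s)) * smooth v x)
  <= 4 * (M - energy (smooth v)).
Proof.
move=> cv v1 c1; set q := smooth v; have cq : continuous q := smooth_continuous cv.
pose w d y : C R := v y + d * v (s + y).
have nc1 : `|- c| = 1 by rewrite normrN.
have cw d : continuous (w d) := @continuous_twist d s v cv.
have qw d x : `|d| = 1 -> smooth (w d) x = 2 * q x + d * q (x + s) + d^* * q (x - s).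
  by move=> d1; exact: (smooth_twist cB minv s x ck cv d1).
have pw d : `|d| = 1 -> acorr (w d) 0 = 2 + (d * acorr v s + d^* * acorr v (- s)).
  by move=> d1; rewrite /w (acorr_twist cB minv s 0 cv d1) v1 add0r sub0r mulr1 addrA.
pose t := c * acorr v s + c^* * acorr v (- s).
pose a := acorr (w c) 0; pose b := acorr (w (- c)) 0.
have aE : a = 2 + t by rewrite /a pw.
have bE : b = 2 - t by rewrite /b pw// rmorphN /= /t; ring.
have a0 : 0 <= a by exact: acorr0_ge0.
have b0 : 0 <= b by exact: acorr0_ge0.
have aJ : a^* = a by rewrite conj_Creal// ger0_real.
have bJ : b^* = b by rewrite conj_Creal// ger0_real.
have cqw d := smooth_continuous (cw d).
have := energy_weighted aJ bJ (cqw c) (cqw (- c)).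
set r := (X in energy X <= _).
have -> : (fun x => b * smooth (w c) x - a * smooth (w (- c)) x) =
          (fun x => 4 * r x).
  apply/funext => x; rewrite !qw// aE bE rmorphN /= /r -/t; ring.
have -> : (fun x => smooth (w c) x + smooth (w (- c)) x) = (fun x => 4 * q x).
  by apply/funext => x; rewrite !qw// rmorphN /=; ring.
have cr : continuous r.
  have cqs (u : B) : continuous (fun x => q (x + u)).
    by under eq_fun do rewrite addrC; exact: continuous_shift.
  have h1 := continuousDC (@continuousZC c _ (cqs s)) (@continuousZC c^* _ (cqs (- s))).
  have h2 := continuousDC h1 (@continuousZC (- t) _ cq).
  rewrite (_ : r = fun x => c * q (x + s) + c^* * q (x + - s) + (- t) * q x)//.
  by apply/funext => x; rewrite /r -/t mulNr.
rewrite (energy_scale _ cr) (energy_scale _ cq).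
have -> : `|4 : C R| = 4 by rewrite ger0_norm.
have ab4 : a + b = 4 by rewrite aE bE; ring.
rewrite ab4 => E.
have ea : energy (smooth (w c)) <= M * a ^+ 2 := energy_le_sqr (cw c).
have eb : energy (smooth (w (- c))) <= M * b ^+ 2 := energy_le_sqr (cw (- c)).
have le16 : 4 ^+ 2 * energy r <= 4 ^+ 2 * (a * b * (M - energy q)).
  rewrite E (_ : 4 ^+ 2 * _ = b * 4 * (M * a ^+ 2) + a * 4 * (M * b ^+ 2) -
    a * b * (4 ^+ 2 * energy q)).
    rewrite lerD2r lerD// ler_wpM2l// mulr_ge0//.
  rewrite (_ : b * 4 * (M * a ^+ 2) + _ = a * b * 4 * M * (a + b)); last by ring.
  by rewrite ab4; ring.
have {le16} er : energy r <= a * b * (M - energy q).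
  by move: le16; rewrite ler_pM2l// exprn_gt0.
apply: (le_trans er); rewrite ler_wpM2r ?subr_ge0 ?energy_le//.
have -> : a * b = 4 - t ^+ 2 by rewrite aE bE; ring.
have tr : t \is Num.real.
  by rewrite (_ : t = a - 2) ?rpredB ?ger0_real// aE; ring.
by rewrite gerBl real_exprn_even_ge0.
Qed.

(* Combine the twists for [c = 1] and [c = 'i]. *)
Lemma smooth_almost_multiplicative (s : B) v : continuous v -> acorr v 0 = 1 ->
  eps * I (fun x => `|smooth v (x + s) - acorr v s * smooth v x| ^+ 2)
  <= 4 * (M - energy (smooth v)).
Proof.
move=> cv v1; set q := smooth v; have cq : continuous q := smooth_continuous cv.
have h1 := energy_twist s cv v1 (normr1 _).
have h2 := energy_twist s cv v1 (@normCi _).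
set r1 := (X in energy X <= _) in h1; set r2 := (X in energy X <= _) in h2.
have cqs (u : B) : continuous (fun x => q (x + u)).
  by under eq_fun do rewrite addrC; exact: continuous_shift.
have cr (c d : C R) : continuous (fun x => c * q (x + s) + c^* * q (x - s) - d * q x).
  have h := continuousDC (@continuousZC c _ (cqs s)) (@continuousZC c^* _ (cqs (- s))).
  have := continuousDC h (@continuousZC (- d) _ cq).
  by under eq_fun do rewrite mulNr.
have cr1 : continuous r1 by exact: cr.
have cr2 : continuous r2 by exact: cr.
have b1 := bmeas_sqr_continuous cB cr1; have b2 := bmeas_sqr_continuous cB cr2.
have b12 : bmeas (fun x : borel B => 2^-1 * (`|r1 x| ^+ 2 + `|r2 x| ^+ 2)).
  exact: bmeasM (bmeas_cst _) (bmeasD b1 b2).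
pose r x := q (x + s) - acorr v s * q x.
have cr' : continuous r.
  have := continuousDC (cqs s) (@continuousZC (- acorr v s) _ cq).
  by under eq_fun do rewrite mulNr.
have bl : I (fun x => `|r x| ^+ 2) <= I (fun x => 2^-1 * (`|r1 x| ^+ 2 + `|r2 x| ^+ 2)).
  apply: le_Cintegral => // [|x]; first exact: bmeas_sqr_continuous.
  have -> : r x = 2^-1 * (r1 x - 'i * r2 x).
    rewrite /r /r1 /r2 conjCi rmorph1 -/q.
    have i2 : 'i * 'i = -1 :> C R by rewrite -expr2 sqrCi.
    rewrite (_ : 'i * (_ - _) = 'i * 'i * (q (x + s) - q (x - s) - (acorr v s - acorr v (- s)) * q x)).
      by rewrite i2; field.
    by ring.
  rewrite normrM exprMn.
  set A := r1 x; set D := r2 x.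
  have par : `|A - 'i * D| ^+ 2 + `|A + 'i * D| ^+ 2 = 2 * (`|A| ^+ 2 + `|D| ^+ 2).
    have -> : `|D| ^+ 2 = `|'i * D| ^+ 2 by rewrite normrM normCi mul1r.
    exact: parallelogram.
  have -> : `|2^-1 : C R| ^+ 2 = 2^-1 * 2^-1.
    by rewrite ger0_norm ?invr_ge0// expr2.
  have le2 : `|A - 'i * D| ^+ 2 <= 2 * (`|A| ^+ 2 + `|D| ^+ 2).
    by rewrite -par lerDl exprn_ge0.
  by rewrite -mulrA ler_wpM2l ?invr_ge0// ler_pdivrMl.
apply: (le_trans (ler_wpM2l (ltW eps0) bl)).
rewrite (CintegralZ _ _ (bmeasD b1 b2)) (CintegralD _ b1 b2) mulrCA mulrDr.
have e1 := le_trans (energy_integral r1) h1.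
have e2 := le_trans (energy_integral r2) h2.
apply: (le_trans (ler_wpM2l _ (lerD e1 e2))); first by rewrite invr_ge0.
by rewrite ler_pdivrMl// (mulr_natl _ 2) mulr2n.
Qed.

End ExtremalCharacter.

Section CharacterExistence.
Context {R : realType} {B : topologicalZmodType}.
Hypothesis cB : compact_group B.

Lemma cvg_norm_le (I : Type) (G : set_system I) (u : I -> C R) (l M : C R) :
  ProperFilter G -> u @ G --> l -> (forall i, `|u i| <= M) -> `|l| <= M.
Proof.
move=> PG /cvgrPdist_lt ul uM; apply/ler_addgt0Pr => e e0.
have [i li] := filter_ex (ul e e0).
rewrite -(subrK (u i) l) (le_trans (ler_normD _ _))// addrC lerD//.
exact: ltW.
Qed.

Definition equicontinuous_family (I : Type) (u : I -> B -> C R) :=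
  forall e : C R, 0 < e ->
    \forall h \near (0 : B), forall i x, `|u i (x + h) - u i x| <= e.

Lemma equicontinuous_limit (I : Type) (G : set_system I) (u : I -> B -> C R)
    (l : B -> C R) : ProperFilter G -> equicontinuous_family u ->
  (forall x, (fun i => u i x) @ G --> l x) ->
  forall e : C R, 0 < e ->
    \forall h \near (0 : B), forall x, `|l (x + h) - l x| <= e.
Proof.
move=> PG eu ul e e0; have := eu e e0; apply: filterS => h uh x.
apply: (@cvg_norm_le _ G (fun i => u i (x + h) - u i x)) => [|i].
  exact: (cvgB (ul (x + h)) (ul x)).
exact: uh.
Qed.

Lemma equicontinuous_cvg_uniform (I : Type) (G : set_system I)
    (u : I -> B -> C R) (l : B -> C R) : ProperFilter G ->
  equicontinuous_family u -> (forall x, (fun i => u i x) @ G --> l x) ->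
  forall e : C R, 0 < e -> \forall i \near G, forall x, `|u i x - l x| <= e.
Proof.
move=> PG eu ul e e0; have e3 : 0 < e / 3 by rewrite divr_gt0.
have [+ _] := cB; rewrite compact_near_coveringP.
move=> /(_ I G (fun i x => `|u i x - l x| <= e)) H.
have {H} : \forall i \near G, [set: B] `<=` (fun x => `|u i x - l x| <= e).
  apply: H => x _; have n1 := eu _ e3; have n2 := equicontinuous_limit PG eu ul e3.
  have n0 : nbhs (- x + x) [set h : B | (forall i z, `|u i (z + h) - u i z| <= e / 3)
      /\ (forall z, `|l (z + h) - l z| <= e / 3)].
    by rewrite addNr; exact: filterI.
  have nx : \forall y \near x, (forall i z, `|u i (z + (- x + y)) - u i z| <= e / 3)
      /\ (forall z, `|l (z + (- x + y)) - l z| <= e / 3).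
    exact: (@continuous_addl B (- x) x _ n0).
  have /cvgrPdist_lt/(_ _ e3) nG := ul x.
  exists ([set y | (forall i z, `|u i (z + (- x + y)) - u i z| <= e / 3)
      /\ (forall z, `|l (z + (- x + y)) - l z| <= e / 3)],
      [set i | `|l x - u i x| < e / 3]) => //=.
  move=> [y i] /= [[uxy lxy] h3].
  have := uxy i x; have := lxy x; rewrite addrA subrr add0r => h2 h1.
  have -> : u i y - l y = (u i y - u i x) - (l x - u i x) - (l y - l x) by ring.
  have -> : e = e / 3 + e / 3 + e / 3 by field.
  rewrite (le_trans (ler_normB _ _))// lerD//.
  by rewrite (le_trans (ler_normB _ _))// lerD// ltW.
by apply: filterS => i ui x; exact: ui.
Qed.

Context (m : probability (borel B) R).
Hypothesis minv : translation_invariant m.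
Local Notation I f := (Cintegral m (f : borel B -> C R)).
Implicit Types v : B -> C R.

Lemma acorr_eq_period v (s : B) : continuous v ->
  acorr m v s = acorr m v 0 -> forall y, v (s + y) = v y.
Proof.
move=> cv vs y; have cvs := @continuous_shift R B v s cv.
pose D y := v (s + y) - v y.
have cD : continuous D by move=> z; exact: (cvgB (cvs z) (cv z)).
suff D0 : forall z, D z = 0 by have /eqP := D0 y; rewrite subr_eq0 => /eqP.
apply: (Cintegral_sqr_eq0_continuous cB minv cD).
have b1 := bmeas_sqr_continuous cB cvs; have b2 := bmeas_sqr_continuous cB cv.
have b3 := bmeas_acorr0 cB s cv; have b4 := bmeasJ b3.
rewrite (_ : (fun x => _) = (fun z => (`|v (s + z)| ^+ 2 + `|v z| ^+ 2) -
  (v (s + z) * (v z)^* + (v (s + z) * (v z)^*)^*))); last first.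
  apply/funext => z; rewrite /D !normCK rmorphB rmorphM /= conjCK; ring.
rewrite (CintegralB _ (bmeasD b1 b2) (bmeasD b3 b4)).
rewrite (CintegralD _ b1 b2) (CintegralD _ b3 b4) (CintegralJ _ b3).
rewrite (Cintegral_addl minv s b2) -acorr0 -/(acorr m v s) vs.
by rewrite conj_Creal ?ger0_real ?acorr0_ge0// subrr.
Qed.

Lemma conv_acorr v (x : B) : continuous v ->
  conv m (acorr m v) (acorr m v) x = acorr m (acorr m v) x.
Proof.
move=> cv; have cp := acorr_continuous cB minv cv.
rewrite /conv -(Cintegral_addl minv x (bmeas_conv cB x cp cp)).
congr Cintegral; apply/funext => y; rewrite opprD addrA subrr add0r.
by rewrite (acorrN cB minv) // mulrC.
Qed.

(* The kernel is [acorr m u] itself, so that [conv_acorr] turns the smoothed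
   autocorrelation into an iterated one, and [acorr_eq_period] applies twice. *)
Lemma smooth_separates (u : B -> C R) (x0 : B) : continuous u -> u 0 != u x0 ->
  exists2 k : B -> C R, continuous k &
    exists v, [/\ continuous v, acorr m v 0 = 1 &
      smooth m k v 0 != smooth m k v x0].
Proof.
move=> cu u0; set p := acorr m u; have cp : continuous p by exact: acorr_continuous.
have px0 : p x0 != p 0.
  apply/eqP => /(acorr_eq_period cu)/(_ 0); rewrite addr0 => E.
  by rewrite E eqxx in u0.
have ppx0 : acorr m p x0 != acorr m p 0.
  apply/eqP => /(acorr_eq_period cp)/(_ 0); rewrite addr0 => E.
  by rewrite E eqxx in px0.
exists p => //.
have N0 : 0 < p 0.
  rewrite lt0r acorr0_ge0 andbT; apply/eqP => pz; move/eqP: px0; apply.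
  apply/eqP; rewrite pz -normr_le0 -[leRHS]pz; exact: norm_acorr_le.
pose c := (sqrtC (p 0))^-1.
have c2 : `|c| ^+ 2 = (p 0)^-1.
  by rewrite /c normfV ger0_norm ?sqrtC_ge0 ?ltW// exprVn sqrtCK.
exists (fun y => c * u y); split; first exact: continuousZC.
  by rewrite acorr_scale// c2 mulVf// gt_eqF.
rewrite !(smooth_scale cB minv c _ cp cu) /smooth -/p !conv_acorr//.
have c0 : `|c| ^+ 2 != 0 by rewrite c2 invr_eq0 gt_eqF.
by rewrite (inj_eq (mulfI c0)) eq_sym.
Qed.

End CharacterExistence.

Section CharacterLimit.
Context {R : realType} {B : topologicalZmodType}.
Hypothesis cB : compact_group B.
Context (m : probability (borel B) R).
Hypothesis minv : translation_invariant m.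
Implicit Types v q : B -> C R.
Local Notation I f := (Cintegral m (f : borel B -> C R)).

Variables (k : B -> C R) (x0 : B) (eps K : C R).
Hypotheses (ck : continuous k) (eps0 : 0 < eps) (kK : forall x, `|k x| <= K).
Local Notation smooth := (smooth m k).
Local Notation acorr := (acorr m).
Local Notation energy := (energy m x0 eps).

Lemma ge0_ReC (z : C R) : 0 <= z -> z = (complex.Re z)%:C%C.
Proof. by case: z => a b; rewrite lecE /= => /andP[/eqP-> _]. Qed.

Lemma maximizing_sequence v0 : continuous v0 -> acorr v0 0 = 1 ->
  exists M : C R,
    (forall v, continuous v -> acorr v 0 = 1 -> energy (smooth v) <= M) /\
    exists v : nat -> B -> C R, forall n, [/\ continuous (v n),
      acorr (v n) 0 = 1 & M - n.+1%:R^-1 < energy (smooth (v n))].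
Proof.
move=> cv0 v01; pose S : set R := [set complex.Re (energy (smooth v)) |
  v in [set v | continuous v /\ acorr v 0 = 1]].
have eRe v : energy (smooth v) = (complex.Re (energy (smooth v)))%:C%C.
  exact/ge0_ReC/energy_ge0.
have K0 : 0 <= K by apply: le_trans (kK 0).
have hS : has_sup S.
  split; first by exists (complex.Re (energy (smooth v0))), v0.
  exists (complex.Re ((2 * K) ^+ 2 + eps * K ^+ 2)) => _ [v [cv v1] <-].
  have vK x : `|smooth v x| <= K.
    by have := smooth_bound cB minv ck kK x cv; rewrite v1 mulr1.
  have := energy_bound cB m x0 eps0 (smooth_continuous cB minv ck cv) vK.
  set e := energy _ => eb; have : e <= (2 * K) ^+ 2 + eps * K ^+ 2.
    apply: (le_trans eb); rewrite lerD2r lerXn2r ?nnegrE// ?mulr_ge0//.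
    by rewrite (le_trans (ler_normB _ _))// mulr_natl mulr2n lerD.
  by rewrite lecE => /andP[].
exists (sup S)%:C%C; split.
  move=> v cv v1; rewrite eRe lecR; apply: sup_upper_bound => //.
  by exists v.
have /choice[v vP] : forall n : nat, exists v, [/\ continuous v,
    acorr v 0 = 1 & (sup S)%:C%C - n.+1%:R^-1 < energy (smooth v)].
  move=> n; have n0 : 0 < (n.+1%:R^-1 : R) by rewrite invr_gt0.
  have [_ [v [cv v1] <-] nv] := sup_adherent n0 hS.
  by exists v; split=> //; rewrite natVC -rmorphB eRe ltcR.
by exists v.
Qed.

Lemma near_infty_natV (e : C R) : 0 < e ->
  \forall n \near \oo, (n.+1%:R^-1 : C R) < e.
Proof.
move=> e0; have [n0 n0e] := gt0_natC e0.
exists n0 => // n /= n0n; apply: le_lt_trans n0e.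
by rewrite lef_pV2 ?posrE ?ltr0n// ler_nat.
Qed.

Lemma smooth_equicontinuous (v : nat -> B -> C R) :
  (forall n, continuous (v n)) -> (forall n, acorr (v n) 0 = 1) ->
  equicontinuous_family (fun n => smooth (v n)).
Proof.
move=> cv v1 e e0; have := unif_continuous cB ck e0.
apply: filterS => h kh n x; have cp := acorr_continuous cB minv (cv n).
have pb y : `|acorr (v n) y| <= 1 by have := norm_acorr_le cB minv y (cv n); rewrite v1.
by have := conv_equicontinuous cB m ck cp kh pb x; rewrite mulr1.
Qed.

Section Limit.
Context (M : C R) (v : nat -> B -> C R).
Hypotheses (energy_le : forall v, continuous v -> acorr v 0 = 1 ->
                          energy (smooth v) <= M)
  (cv : forall n, continuous (v n)) (v1 : forall n, acorr (v n) 0 = 1)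
  (vM : forall n, M - n.+1%:R^-1 < energy (smooth (v n))).
Context (G : set_system nat).
Hypotheses (PG : ProperFilter G) (Goo : \oo `<=` G).
Context (q chi : B -> C R).
Hypotheses (vq : forall x, (fun n => smooth (v n) x) @ G --> q x)
  (vchi : forall s, (fun n => acorr (v n) s) @ G --> chi s).

Lemma limit_multiplicative (s x : B) : q (x + s) = chi s * q x.
Proof.
pose r n y := smooth (v n) (y + s) - acorr (v n) s * smooth (v n) y.
pose l y := q (y + s) - chi s * q y.
suff l0 : forall y, l y = 0 by have /eqP := l0 x; rewrite subr_eq0 => /eqP.
have pb n y : `|acorr (v n) y| <= 1 by have := norm_acorr_le cB minv y (@cv n); rewrite v1.
have er : equicontinuous_family r.
  move=> e e0; have e20 : 0 < e / 2 by rewrite divr_gt0.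
  have := smooth_equicontinuous cv v1 e20; apply: filterS => h vh n y.
  have -> : r n (y + h) - r n y = (smooth (v n) (y + s + h) - smooth (v n) (y + s))
      - acorr (v n) s * (smooth (v n) (y + h) - smooth (v n) y).
    by rewrite /r (addrAC y h s); ring.
  rewrite (le_trans (ler_normB _ _))// (splitr e) lerD// normrM.
  by rewrite -[leRHS]mul1r ler_pM.
have rl y : (fun n => r n y) @ G --> l y.
  have h : (fun n => acorr (v n) s * smooth (v n) y) @ G --> chi s * q y.
    exact: (cvgM (@vchi s) (@vq y)).
  exact: (cvgB (@vq (y + s)) h).
have cl : continuous l.
  exact: (unif_continuous_continuous (equicontinuous_limit PG er rl)).
have cr n : continuous (r n).
  have csv := smooth_continuous cB minv ck (@cv n).
  move=> y; apply: cvgB; last by apply: cvgM; [exact: cvg_cst|exact: csv].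
  have cs : continuous (fun y => smooth (v n) (y + s)).
    by under eq_fun do rewrite addrC; exact: continuous_shift.
  exact: cs.
apply: (Cintegral_sqr_eq0_continuous cB minv cl).
have Il0 : 0 <= I (fun y => `|l y| ^+ 2).
  by apply: Cintegral_ge0 => y; exact: exprn_ge0.
suff Il : eps * I (fun y => `|l y| ^+ 2) <= 0.
  by apply/eqP; rewrite eq_le Il0 andbT -(ler_pM2l eps0) mulr0.
apply/ler_addgt0Pr => d d0; rewrite add0r.
pose e := sqrtC (d / (4 * eps)).
have de0 : 0 < d / (4 * eps) by rewrite divr_gt0// mulr_gt0.
have e0 : 0 < e by rewrite sqrtC_gt0.
have e2 : e ^+ 2 = d / (4 * eps) by rewrite sqrtCK.
have d16 : 0 < d / 16 by rewrite divr_gt0.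
have [n [nd rle]] := filter_ex (filterI (Goo (near_infty_natV d16))
  (equicontinuous_cvg_uniform cB PG er rl e0)).
have b1 := bmeas_sqr_continuous cB (cr n).
have bl := bmeas_sqr_continuous cB cl.
have b1' := bmeasM (bmeas_cst 2) b1.
have be : bmeas (fun _ : borel B => 2 * e ^+ 2) by exact: bmeas_cst.
have : I (fun y => `|l y| ^+ 2) <= I (fun y => 2 * `|r n y| ^+ 2 + 2 * e ^+ 2).
  apply: le_Cintegral => // [|y]; first exact: bmeasD.
  have par := parallelogram (r n y) (r n y - l y).
  apply: (@le_trans _ _ (2 * `|r n y| ^+ 2 + 2 * `|r n y - l y| ^+ 2)).
    rewrite -mulrDr -par (_ : r n y - (r n y - l y) = l y); last by ring.
    by rewrite lerDl exprn_ge0.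
  by rewrite lerD2l ler_wpM2l// lerXn2r ?nnegrE// ltW.
rewrite (CintegralD _ b1' be) (CintegralZ _ _ b1) Cintegral_cst => Ile.
apply: (le_trans (ler_wpM2l (ltW eps0) Ile)).
have am := smooth_almost_multiplicative cB minv ck eps0 kK energy_le s (@cv n) (v1 n).
have -> : eps * (2 * I (fun y => `|r n y| ^+ 2) + 2 * e ^+ 2) =
  2 * (eps * I (fun y => `|r n y| ^+ 2)) + d / 2.
  by rewrite e2; field; rewrite gt_eqF.
rewrite [leRHS]splitr lerD2r.
have am' : eps * I (fun y => `|r n y| ^+ 2) <= 4 * (d / 16).
  apply: (le_trans am); rewrite ler_wpM2l// (le_trans _ (ltW nd))//.
  by rewrite lerBlDl -lerBlDr ltW// vM.
apply: (le_trans (ler_wpM2l _ am')) => //.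
by rewrite (_ : 2 * (4 * (d / 16)) = d / 2)//; field.
Qed.

Lemma limit_separates (L : C R) : 0 < L -> L <= M -> eps * K ^+ 2 <= L / 2 ->
  q 0 <> q x0.
Proof.
move=> L0 LM epsL q0; have K0 : 0 <= K by apply: le_trans (kK 0).
pose d := sqrtC (L / 8); have L8 : 0 < L / 8 by rewrite divr_gt0.
have d0 : 0 < d by rewrite sqrtC_gt0.
have d2 : d ^+ 2 = L / 8 by rewrite sqrtCK.
have cq0 : (fun n => smooth (v n) 0 - smooth (v n) x0) @ G --> q 0 - q x0.
  exact: (cvgB (@vq 0) (@vq x0)).
have /cvgrPdist_lt/(_ _ d0) nd := cq0.
have [n [/= nL]] := filter_ex (filterI (Goo (near_infty_natV L8)) nd).
rewrite q0 subrr sub0r normrN => qnd.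
have vK x : `|smooth (v n) x| <= K.
  by have := smooth_bound cB minv ck kK x (@cv n); rewrite v1 mulr1.
have eb := energy_bound cB m x0 eps0 (smooth_continuous cB minv ck (@cv n)) vK.
have qd : `|smooth (v n) 0 - smooth (v n) x0| ^+ 2 <= L / 8.
  by rewrite -d2 lerXn2r ?nnegrE// ltW.
have : L - L / 8 < L / 8 + L / 2.
  apply: (lt_le_trans (le_lt_trans _ (vM n))).
    by rewrite lerB// ltW.
  by rewrite (le_trans eb)// lerD.
rewrite -subr_gt0 (_ : _ - _ = - (L / 4)); last by field.
by rewrite oppr_gt0 => /lt_trans => /(_ _ (divr_gt0 L0 (ltr0n _ 4))); rewrite ltxx.
Qed.

End Limit.
End CharacterLimit.

Lemma exists_character (R : realType) (B : topologicalZmodType)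
    (cB : compact_group B) (m : probability (borel B) R)
    (minv : translation_invariant m) (u : B -> C R) (x0 : B) :
  continuous u -> u 0 != u x0 ->
  exists chi : B -> C R, [/\ continuous chi, forall x, `|chi x| = 1,
    forall x y, chi (x + y) = chi x * chi y & chi x0 != 1].
Proof.
move=> cu ux0; have [k ck [v0 [cv0 v01 kv0]]] := smooth_separates cB minv cu ux0.
have [K kK] := continuous_bounded cB ck.
have K0 : 0 <= K by apply: le_trans (kK 0).
pose L := `|smooth m k v0 0 - smooth m k v0 x0| ^+ 2.
have L0 : 0 < L by rewrite exprn_gt0// normr_gt0 subr_eq0.
have L20 : 0 < L / 2 by rewrite divr_gt0.
pose eps := L / 2 / (K ^+ 2 + 1).
have eps0 : 0 < eps by rewrite divr_gt0// ltr_wpDl// exprn_ge0.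
have epsL : eps * K ^+ 2 <= L / 2 by apply: div_mul_le => //; exact: exprn_ge0.
have [M [eM [v vP]]] := maximizing_sequence cB minv x0 ck eps0 kK cv0 v01.
have cv n : continuous (v n) by case: (vP n).
have v1 n : acorr m (v n) 0 = 1 by case: (vP n).
have vM n : M - n.+1%:R^-1 < energy m x0 eps (smooth m k (v n)) by case: (vP n).
have LM : L <= M.
  apply: le_trans (eM _ cv0 v01); rewrite lerDl mulr_ge0 ?(ltW eps0)//.
  by apply: Cintegral_ge0 => x; exact: exprn_ge0.
have [G [GU Goo]] := ultraFilterLemma eventually_filter.
have qb x n : `|smooth m k (v n) x| <= K.
  by have := smooth_bound cB minv ck kK x (cv n); rewrite v1 mulr1.
have pb y n : `|acorr m (v n) y| <= 1.
  by have := norm_acorr_le cB minv y (cv n); rewrite v1.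
have [q vq] := bounded_ultra_cvg_fun GU qb.
have [chi vchi] := bounded_ultra_cvg_fun GU pb.
have PG : ProperFilter G := @ultra_proper _ _ GU.
have qchi := limit_multiplicative cB minv ck eps0 kK eM cv v1 vM PG Goo vq vchi.
have q0x0 := limit_separates cB minv ck eps0 kK cv v1 vM PG Goo vq L0 LM epsL.
have q0E s : q s = chi s * q 0 by rewrite -qchi add0r.
have q00 : q 0 != 0.
  by apply/eqP => q0; apply: q0x0; rewrite [RHS]q0E q0 mulr0.
have chiM x y : chi (x + y) = chi x * chi y.
  apply: (mulIf q00); rewrite -q0E (addrC x y) qchi (q0E y).
  by rewrite mulrA.
have chi0 : chi 0 = 1 by apply: (mulIf q00); rewrite -q0E mul1r.
have chi_le x : `|chi x| <= 1 := cvg_norm_le PG (vchi x) (pb x).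
exists chi; split; [|move=> x|exact: chiM|].
- have cq : continuous q.
    apply: unif_continuous_continuous.
    exact: equicontinuous_limit PG (smooth_equicontinuous cB minv ck cv v1) vq.
  rewrite (_ : chi = fun x => (q 0)^-1 * q x); first exact: continuousZC.
  by apply/funext => x; rewrite (q0E x) mulrCA mulVf// mulr1.
- apply/eqP; rewrite eq_le chi_le /=.
  have <- : `|chi (x - x)| = 1 by rewrite subrr chi0 normr1.
  by rewrite chiM normrM ler_piMr.
- by apply: contra_notN q0x0 => /eqP x1; rewrite [RHS]q0E x1 mul1r.
Qed.

(** * Characters generate the Borel sets *)

Section CharactersSeparate.
Context {R : realType} {B : topologicalZmodType}.
Hypothesis cB : compact_group B.
Context (m : probability (borel B) R).
Hypothesis minv : translation_invariant m.

Lemma real_complex_continuous : continuous (fun x : R => x%:C%C : C R).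
Proof.
move=> x; apply/cvgrPdist_lt => e e0; have [r r0 ->] := gt0_Re e0.
have : \forall y \near x, `|x - y| < r by exact: (@cvgr_dist_lt _ _ _ (nbhs x) _ id x).
apply: filterS => y xy; rewrite -rmorphB normc_def ltcR /= expr0n /= addr0.
by rewrite sqrtr_sqr.
Qed.

Lemma continuous_separates (x y : B) : x != y ->
  exists2 u : B -> C R, continuous u & u x != u y.
Proof.
move=> xy; have [cT hB] := cB.
have cl z : closed [set z : B].
  by apply: accessible_closed_set1; exact: hausdorff_accessible.
have [|f [cf _ f0 f1]] := (@uniform_separatorP B R [set x] [set y]).1.
  apply: (@normal_separatorP R B).1; [exact: compact_normal|exact: cl|exact: cl|].
  by apply/seteqP; split=> // z [/= -> /eqP]; rewrite (negbTE xy).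
exists (fun z => (f z)%:C%C).
  move=> z; apply: (@continuous_comp _ _ _ f (fun x : R => x%:C%C : C R)).
    exact: cf.
  exact: real_complex_continuous.
have -> : f x = 0 by apply: f0; exists x.
have -> : f y = 1 by apply: f1; exists y.
by rewrite eq_complex /= negb_and eq_sym oner_eq0.
Qed.

Lemma character_separates (x y : B) : x != y ->
  exists chi : dual R (topology_sigma B), chi x != chi y.
Proof.
move=> xy; have [u cu] := continuous_separates xy; rewrite -[x]addr0.
have [u' [cu' u0]] : exists u' : B -> C R, continuous u' /\ u' 0 != u' (y - x).
  have [|u' cu' u0] := @continuous_separates 0 (y - x); last by exists u'.
  by rewrite eq_sym subr_eq0 eq_sym.
move=> _; have [chi [cchi chi1 chiM chixy]] := exists_character cB minv cu' u0.
have lchi : linear_character (topology_sigma B) chi.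
  by split=> // U oU; move/continuousP : cchi; exact.
exists (Dual (asboolT lchi)) => /=; apply: contra_neq chixy => exy.
have chix : chi x != 0 by rewrite -normr_gt0 chi1.
apply: (mulfI chix); rewrite mulr1 -chiM addrC subrK.
by rewrite -[x in RHS]addr0.
Qed.

End CharactersSeparate.

Section SecondCountable.
Context {T : topologicalType}.

Lemma second_countable_seq : @second_countable T ->
  exists b : nat -> set T, (forall n, open (b n)) /\
    forall x U, nbhs x U -> exists2 n, b n x & b n `<=` U.
Proof.
move=> [D /countable_injP[f fI] [Do Dn]].
pose P n := [set S | D S /\ f S = n].
exists (fun n => xget set0 (P n)); split.
  by move=> n; case: xgetP => [S _ [/Do]|_]; [|exact: open0].
move=> x U /Dn[S [DS Sx] SU]; exists (f S).
  case: xgetP => [S' _ [DS' /fI e]|/(_ S)[]]; last by split.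
  by rewrite e ?inE.
case: xgetP => [S' _ [DS' /fI e]|_]; last exact: sub0set.
by rewrite e ?inE.
Qed.

Lemma second_countable_sigma (G : set (set T)) (U : set T) :
  @second_countable T -> sigma_algebra setT G ->
  (forall x, U x -> exists N, [/\ nbhs x N, G N & N `<=` U]) -> G U.
Proof.
move=> /second_countable_seq[b [bo bn]] [G0 _ GU] UN.
pose P n := [set N | [/\ G N, N `<=` U & b n `<=` N]].
have -> : U = \bigcup_n xget set0 (P n).
  apply/seteqP; split=> [x Ux|x [n _]]; last first.
    by case: xgetP => [N _ [_ NU _] /NU|//].
  have [N [xN GN NU]] := UN x Ux; have [n bnx bnN] := bn _ _ xN.
  exists n => //; case: xgetP => [N' _ [_ _]|/(_ N)[]]; first exact.
  by split.
by apply: GU => n; case: xgetP => [N _ []|_].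
Qed.

End SecondCountable.

Section CharacterSigmaAlgebra.
Context {R : realType} {B : topologicalZmodType}.
Hypothesis cB : compact_group B.
Context (m : probability (borel B) R).
Hypothesis minv : translation_invariant m.

Definition character_generators : set (set B) :=
  [set V | exists chi : dual R (topology_sigma B),
     exists2 U : set (C R), open U & V = chi @^-1` U].

(* The filter generated by the character-measurable open neighbourhoods of [x]
   separates [x] from the compact set [~` U]. *)
Lemma open_character_sigma (U : set B) : @second_countable B -> open U ->
  <<s character_generators >> U.
Proof.
move=> scB oU; apply: (second_countable_sigma scB).
  exact: smallest_sigma_algebra.
move=> x Ux.
pose good := [set N : set B | [/\ open N, N x & <<s character_generators >> N]].
have gch (chi : dual R (topology_sigma B)) (V : set (C R)) : open V -> V (chi x) ->
    good (chi @^-1` V).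
  move=> oV Vx; split=> //.
    by have [_ _ ochi] := dualP chi; exact: ochi.
  by apply: sub_sigma_algebra; exists chi, V.
have gI N1 N2 : good N1 -> good N2 -> good (N1 `&` N2).
  move=> [op1 x1 s1] [op2 x2 s2]; split; [exact: openI|by []|].
  exact: (@measurableI _ (gen_sigma B character_generators)).
have FF : Filter (filter_from good id).
  apply: filter_from_filter.
    exists setT; split=> //; first exact: openT.
    exact: (@measurableT _ (gen_sigma B character_generators)).
  by move=> N1 N2 g1 g2; exists (N1 `&` N2) => //; exact: gI.
have [cT hB] := cB.
have cK : compact (~` U).
  by apply: (subclosed_compact _ cT) => //; exact: open_closedC.
move: cK; rewrite compact_near_coveringP.
move=> H; have [] := H B (filter_from good id) (fun i y => i <> y) FF.
  move=> y Uy; have xy : x != y by apply/eqP => xy; apply: Uy; rewrite -xy.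
  have [chi chixy] := character_separates cB minv xy.
  have := C_hausdorff (R := R); rewrite open_hausdorff => /(_ _ _ chixy)[[V W] /=].
  rewrite !inE; move=> [Vx Wy] [oV oW VW0].
  exists (chi @^-1` W, chi @^-1` V).
    split=> /=; last by exists (chi @^-1` V) => //; exact: gch.
    apply: open_nbhs_nbhs; split=> //.
    by have [_ _ ochi] := dualP chi; exact: ochi.
  move=> [y' i] /= [Wy' Vi] iy; have : (V `&` W) (chi i) by split=> //; rewrite iy.
  by rewrite VW0.
move=> N [oN Nx sN] NU; exists N; split=> //; first exact: open_nbhs_nbhs.
by move=> i /NU iU; apply: contrapT => /iU.
Qed.

End CharacterSigmaAlgebra.

(** * Ultraproducts *)

Lemma probability_image (R : realType) d1 d2 (T1 : measurableType d1)
    (T2 : measurableType d2) (P : probability T1 R) (phi : T1 -> T2) :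
  measurable_fun setT phi ->
  exists P2 : probability T2 R, forall S, P2 S = P (phi @^-1` S).
Proof.
move=> mphi; pose X : {mfun T1 >-> T2} := mfun_Sub (mem_set mphi).
by exists (distribution P X).
Qed.

Section UltraproductMeasure.
Context {R : realType} {w : set_system nat} {wU : UltraFilter w}.
Context {A : nat -> topologicalZmodType}.
Local Notation AA := (ultraproduct wU A).
Local Notation SO := (strongly_open wU A).
Local Notation uprod S := (@uprod w wU A S).

Lemma uclassD (x y : sequences A) : uclass wU (x + y) = uclass wU x + uclass wU y.
Proof. exact: pi_addr. Qed.

Lemma uclass_surj (a : AA) : exists x, a = uclass wU x.
Proof. by exists (repr a); rewrite /uclass reprK. Qed.

Lemma uprodP (S : forall i, set (A i)) (x : sequences A) :
  uprod S (uclass wU x) <-> \forall i \near w, S i (x i).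
Proof.
split=> [[y yS /uclassP yx]|xS]; last by exists x.
by move: yS yx; apply: filterS2 => i yS <-.
Qed.

Lemma uprod_addl (a : sequences A) (S : forall i, set (A i)) :
  (fun x : AA => uclass wU a + x) @^-1` uprod S =
  uprod (fun i => (fun x => a i + x) @^-1` S i).
Proof.
apply/seteqP; split=> b; have [x ->] := uclass_surj b; rewrite /= -uclassD.
  by move=> /uprodP ax; apply/uprodP.
by move=> /uprodP ax; apply/uprodP.
Qed.

Lemma measurable_uopen (U : set AA) : uopen U ->
  measurable (U : set (gen_sigma AA SO)).
Proof.
by move=> [F oF ->]; apply: bigcupT_measurable => n; exact: sub_sigma_algebra.
Qed.

Context (m : forall i, probability (borel (A i)) R).
Hypothesis m_haar : forall i, is_haar (m i).
Context (mu : probability (gen_sigma AA SO) R).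
Hypothesis mu_lim : ultralimit_measure m mu.

Lemma ultralimit_invariant : translation_invariant mu.
Proof.
move=> a; have [x ->{a}] := uclass_surj a.
have mt : measurable_fun setT
    ((fun y : AA => uclass wU x + y) : gen_sigma AA SO -> gen_sigma AA SO).
  apply: (@measurability _ _ _ (gen_sigma AA SO) setT _ SO) => //.
  move=> _ [_ [S oS <-] <-]; rewrite setTI uprod_addl; apply: sub_sigma_algebra.
  exists (fun i => (fun y => x i + y) @^-1` S i) => // i.
  exact: (open_comp (fun y _ => @continuous_addl (A i) (x i) y) (oS i)).
move=> E mE; split; first by rewrite -[X in measurable X]setTI; exact: mt.
have [P PE] := probability_image mu mt; rewrite -[LHS]PE.
apply: (@g_sigma_algebra_measure_unique _ R (gen_sigma AA SO) SO _
  (fun=> setT)) mE => //.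
- exact: sub_sigma_algebra.
- by move=> _; exact: strongly_openT.
- by rewrite bigcup_const.
- by move=> U V; exact: strongly_openI.
- move=> _ [S oS <-]; apply: (etrans (PE _)).
  have cS := mu_lim oS.
  have := mu_lim (S := fun i => (fun y => x i + y) @^-1` S i).
  rewrite -uprod_addl => cS'.
  have {}cS' : m i (S i) @[i --> w] --> mu ((fun y : AA => uclass wU x + y) @^-1` uprod S).
    have {}cS' := cS' (fun i => open_comp (fun y _ => @continuous_addl (A i) (x i) y) (oS i)).
    rewrite (_ : (fun i => m i (S i)) = (fun i => m i ((fun y => x i + y) @^-1` S i)))//.
    apply/funext => i; have [inv _ _] := m_haar i.
    by rewrite inv//; exact: sub_sigma_algebra.
  exact: (cvg_unique _ cS' cS).
- by move=> _; exact: le_lt_trans (probability_le1 P measurableT) (ltry _).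
Qed.

Hypothesis w_nonprincipal : forall n : nat, w <> principal_filter n.

Lemma near_ultra_ge (n : nat) : \forall i \near w, (n <= i)%N.
Proof.
have [//|wn] := in_ultra_setVsetC [set i : nat | (n <= i)%N] wU.
exfalso; elim: n wn => [|n IH] wn.
  by have [i ni] := filter_ex wn; apply: ni.
have [wn1|wn1] := in_ultra_setVsetC [set n] wU; last first.
  apply: IH; move: wn wn1; apply: filterS2 => i /= ni nin ni'; apply: ni.
  by rewrite ltn_neqAle ni' andbT; apply/eqP => e; apply: nin.
apply: (w_nonprincipal (n := n)).
have pn : ProperFilter (principal_filter n) by exact: principal_filter_proper.
apply/esym; apply: max_filter => V wV.
have [i [-> Vn]] := filter_ex (filterI wn1 wV).
exact/principal_filterP.
Qed.

(* Diagonal argument: the point missing every [uprod (S n)] is glued from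
   points missing the first [N] of them, for larger and larger [N]. *)
Lemma uprod_countably_compact (S : nat -> forall i, set (A i)) :
  \bigcup_n uprod (S n) = setT ->
  exists N, forall a, exists2 n, (n < N)%N & uprod (S n) a.
Proof.
move=> ST; apply: contrapT => noN.
have /choice[x xP] : forall N, exists x : sequences A,
    forall n, (n < N)%N -> ~ uprod (S n) (uclass wU x).
  move=> N; apply: contrapT => nox; apply: noN; exists N => a.
  apply: contrapT => na; apply: nox; have [x ax] := uclass_surj a.
  by exists x => n nN Sx; apply: na; exists n => //; rewrite ax.
pose good N i := (N <= i)%N /\ forall n, (n < N)%N -> ~ S n i (x N i).
have nearG N : \forall i \near w, good N i.
  suff : forall K, (K <= N)%N ->
      \forall i \near w, forall n, (n < K)%N -> ~ S n i (x N i).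
    by move=> /(_ N (leqnn N)); apply: filterS2 (near_ultra_ge N) => i Ni; split.
  elim=> [_|K IH KN]; first exact: nearW.
  have [SK|] := in_ultra_setVsetC [set i | S K i (x N i)] wU.
    by exfalso; apply: (xP N K KN); apply/uprodP.
  apply: filterS2 (IH (ltnW KN)) => i Si SKi n.
  by rewrite ltnS leq_eqVlt => /predU1P[->|/Si].
have good0 i : exists N, `[< good N i >] by exists 0%N; apply/asboolP.
have goodi i N : `[< good N i >] -> (N <= i)%N by move=> /asboolP[].
pose y : sequences A := fun i => x (ex_maxn (good0 i) (goodi i)) i.
have : (\bigcup_n uprod (S n)) (uclass wU y) by rewrite ST.
move=> [n _ /uprodP Sy].
have [i [/= Siy gi]] := filter_ex (filterI Sy (nearG n.+1)).
move: Siy; rewrite /y; case: ex_maxnP => N /asboolP[_ gN] /(_ n.+1).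
by move=> /(_ (asboolT gi)) nN; exact: gN.
Qed.

Lemma ultraproduct_countably_compact (F : nat -> set AA) :
  (forall n, uopen (F n)) -> \bigcup_n F n = setT ->
  exists N, forall a, exists2 n, (n < N)%N & F n a.
Proof.
move=> oF FT.
have /choice[S SP] : forall n, exists S : nat -> forall i, set (A i),
    F n = \bigcup_k uprod (S k).
  move=> n; have [D oD FD] := oF n.
  have /choice[S SP] : forall k, exists S, uprod S = D k.
    by move=> k; have [S _ SD] := oD k; exists S.
  by exists S; rewrite FD; apply: eq_bigcup => // k _; rewrite SP.
pose S' j := if unpickle j is Some p then S p.1 p.2 else fun=> set0.
have [|N NP] := @uprod_countably_compact S'.
  apply/seteqP; split=> // a _; have : (\bigcup_n F n) a by rewrite FT.
  move=> [n _]; rewrite SP => -[k _ ak]; exists (pickle (n, k)) => //.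
  by rewrite /S' pickleK.
exists (\max_(j < N) oapp fst 0 (unpickle j : option (nat * nat)))%N.+1 => a.
have [j jN] := NP a; rewrite /S'.
case ej : (unpickle j : option (nat * nat)) => [[n k]|] /= Sa; last first.
  by have [x xa] := uclass_surj a; move: Sa; rewrite xa => /uprodP/filter_ex[].
exists n; last by rewrite SP; exists k.
rewrite ltnS; apply: leq_trans (leq_bigmax (Ordinal jN)).
by rewrite /= ej.
Qed.

End UltraproductMeasure.

(** * Support subgroups and Bessel's inequality *)

Section SupportSubgroups.
Context {R : realType}.

Lemma spt_subgroup_closed (G : groupType) (f : G -> C R) :
  group_closed (mem (spt_subgroup f)).
Proof.
split; first by apply/mem_set => H [[H1 _] _]; exact/set_mem.
move=> x y /set_mem xS /set_mem yS; apply/mem_set => H [[H1 HV] fH].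
apply/set_mem/HV; apply/mem_set; [exact: xS|exact: yS].
Qed.

Lemma spt_subgroup_sub (G : groupType) (f : G -> C R) (g : G) :
  f g != 0 -> spt_subgroup f g.
Proof. by move=> fg H [_]; apply. Qed.

Lemma spt_subgroup_min (G : groupType) (f : G -> C R) (H : set G) :
  group_closed (mem H) -> (forall g, f g != 0 -> H g) -> spt_subgroup f `<=` H.
Proof. by move=> gH fH g; apply. Qed.

Lemma ell2_isomorphic_embedding (G1 G2 : groupType) (f1 : G1 -> C R)
    (f2 : G2 -> C R) (alpha : G1 -> G2) : ell2 f1 -> ell2 f2 ->
  {morph alpha : g h / (g * h)%g} -> injective alpha ->
  (forall g, f1 g = f2 (alpha g)) ->
  (forall g, f2 g != 0 -> exists h, g = alpha h) ->
  ell2_isomorphic f1 f2.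
Proof.
move=> l1 l2 aM aI fa fr; split=> //; exists alpha.
have a1 : alpha 1%g = 1%g by apply: (mulIg (alpha 1%g)); rewrite -aM !mul1g.
have aV g : alpha g^-1%g = (alpha g)^-1%g.
  by apply: (mulIg (alpha g)); rewrite -aM !mulVg.
have [s11 s1D] := spt_subgroup_closed f1.
have [s21 s2D] := spt_subgroup_closed f2.
split; last 2 first.
- by move=> g h _ _; exact: aM.
- by move=> g _; exact: fa.
split.
- apply: (@spt_subgroup_min _ f1 (alpha @^-1` spt_subgroup f2)).
    split; first by apply/mem_set; rewrite /= a1; exact/set_mem.
    move=> x y /set_mem /= xS /set_mem /= yS; apply/mem_set; rewrite /= aM aV.
    by apply/set_mem/s2D; exact/mem_set.
  by move=> g fg; apply: spt_subgroup_sub; rewrite -fa.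
- by move=> g h _ _; exact: aI.
- apply: spt_subgroup_min.
    split; first by apply/mem_set; exists 1%g => //; exact/set_mem.
    move=> _ _ /set_mem[x xS <-] /set_mem[y yS <-]; apply/mem_set.
    exists (x / y)%g; last by rewrite aM aV.
    by apply/set_mem/s1D; exact/mem_set.
  move=> g fg; have [h gE] := fr g fg; exists h => //.
  by apply: spt_subgroup_sub; rewrite fa -gE.
Qed.

Lemma ell2_isomorphic_joint (G1 G2 G3 : groupType) (f1 : G1 -> C R)
    (f2 : G2 -> C R) (f3 : G3 -> C R) :
  ell2_isomorphic f1 f3 -> ell2_isomorphic f2 f3 -> ell2_isomorphic f1 f2.
Proof.
move=> [l1 _ [a [[aF aI aS] aM fa]]] [l2 _ [b [[bF bI bS] bM fb]]].
have [s21 s2D] := spt_subgroup_closed f2.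
have s2M := group_closedM (spt_subgroup_closed f2).
have s1M := group_closedM (spt_subgroup_closed f1).
pose c g := xget 1%g [set x | spt_subgroup f2 x /\ b x = a g].
have cP g : spt_subgroup f1 g -> spt_subgroup f2 (c g) /\ b (c g) = a g.
  move=> sg; rewrite /c; case: xgetP => [x _ //|nx].
  by have [x sx bx] := bS _ (aF _ sg); case: (nx x).
split=> //; exists c; split; first split.
- by move=> g /cP[].
- move=> g h /set_mem sg /set_mem sh cgh; apply: aI; try exact/mem_set.
  by rewrite -(cP g sg).2 -(cP h sh).2 cgh.
- move=> y sy; have [x sx ax] := aS _ (bF _ sy); exists x => //.
  have [sc bc] := cP x sx; apply: bI; try exact/mem_set.
  by rewrite bc.
- move=> g h sg sh; have [sc bc] := cP _ (set_mem sg).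
  have [sc' bc'] := cP _ (set_mem sh).
  have [sc'' bc''] := cP _ (set_mem (s1M _ _ sg sh)).
  apply: bI; [exact/mem_set|apply: s2M; exact/mem_set|].
  by rewrite bM; [rewrite bc'' bc bc' aM|exact/mem_set..].
- move=> g sg; have [sc bc] := cP _ (set_mem sg).
  by rewrite fa// fb ?bc//; exact/mem_set.
Qed.

End SupportSubgroups.

Section Bessel.
Context {R : realType} {G : zmodType} {S : set (set G)}.
Context (m : probability (gen_sigma G S) R) (O : sigma_topology G).
Hypothesis minv : translation_invariant m.
Hypothesis mO : forall U, sopen O U -> measurable (U : set (gen_sigma G S)).
Local Notation dual := (dual R O).
Local Notation I f := (Cintegral m (f : gen_sigma G S -> C R)).
Implicit Types (chi psi : dual) (f : G -> C R).

Lemma bmeas_character chi : bmeas (chi : gen_sigma G S -> C R).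
Proof.
have [chi1 _ chiO] := dualP chi.
apply: (@bmeas_open R _ (gen_sigma G S) chi 1) => [U oU|x].
  exact: (mO (chiO U oU)).
by rewrite chi1 lexx.
Qed.

Lemma Cintegral_character_orthogonal chi psi : chi <> psi ->
  I (fun x => chi x * (psi x)^*) = 0.
Proof.
move=> cp; have bc := bmeas_character chi; have bp := bmeas_character psi.
have bcp := bmeasM bc (bmeasJ bp).
have [c1 cD _] := dualP chi; have [p1 pD _] := dualP psi.
have [a ca] : exists a, chi a <> psi a.
  apply: contrapT => na; apply: cp; apply/val_inj/funext => a /=.
  by apply: contrapT => nca; apply: na; exists a.
have : chi a * (psi a)^* != 1.
  apply/eqP => E; apply: ca; rewrite -[LHS]mulr1.
  by rewrite -(expr1n (C R) 2) -(p1 a) normCK [psi a * _]mulrC mulrA E mul1r.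
set z := _ * _ => z1; have : I (fun x => chi x * (psi x)^*) =
    z * I (fun x => chi x * (psi x)^*).
  rewrite -[LHS](Cintegral_addl minv a bcp) -CintegralZ//; congr Cintegral.
  by apply/funext => x; rewrite cD pD rmorphM /= /z; ring.
move=> /eqP; rewrite -subr_eq0 -{1}[Cintegral _ _]mul1r -mulrBl mulf_eq0.
by rewrite subr_eq0 eq_sym (negbTE z1) => /eqP.
Qed.

Lemma fourier_bessel f (s : seq dual) : bmeas (f : gen_sigma G S -> C R) ->
  uniq s ->
  \sum_(chi <- s) `|fourier m f chi| ^+ 2 <= I (fun x => `|f x| ^+ 2).
Proof.
move=> bf; pose g (t : seq dual) x := \sum_(chi <- t) fourier m f chi * chi x.
have bg t : bmeas (g t : gen_sigma G S -> C R).
  elim: t => [|chi t IH].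
    by rewrite /g; under eq_fun do rewrite big_nil; exact: bmeas_cst.
  rewrite /g; under eq_fun do rewrite big_cons; apply: bmeasD => //.
  by apply: bmeasM; [exact: bmeas_cst|exact: bmeas_character].
have bJ chi := bmeasJ (bmeas_character chi).
have gO t chi : chi \notin t -> I (fun x => g t x * (chi x)^*) = 0.
  elim: t => [|psi t IH].
    move=> _; rewrite /g; under eq_fun do rewrite big_nil mul0r.
    exact: Cintegral_cst.
  rewrite inE negb_or => /andP[chipsi /IH IHt].
  have b1 := bmeasM (bmeas_character psi) (bJ chi).
  have b2 := bmeasM (bg t) (bJ chi).
  rewrite (_ : (fun x => _) = (fun x => fourier m f psi * (psi x * (chi x)^*)
      + g t x * (chi x)^*)).
    rewrite (CintegralD _ (bmeasM (bmeas_cst _) b1) b2) (CintegralZ _ _ b1) IHt.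
    rewrite Cintegral_character_orthogonal ?mulr0 ?addr0// => psichi.
    by rewrite psichi eqxx in chipsi.
  by apply/funext => x; rewrite /g big_cons mulrDl mulrA.
suff E : uniq s -> I (fun x => `|f x - g s x| ^+ 2) =
    I (fun x => `|f x| ^+ 2) - \sum_(chi <- s) `|fourier m f chi| ^+ 2.
  move=> us; rewrite -subr_ge0 -E//; apply: Cintegral_ge0 => x.
  exact: exprn_ge0.
elim: s => [_|chi s IH /= /andP[chis us]].
  rewrite big_nil subr0; congr Cintegral; apply/funext => x.
  by rewrite /g big_nil subr0.
rewrite big_cons; set c := fourier m f chi.
have [chi1 _ _] := dualP chi.
have bfg := bmeasB bf (bg s).
have b1 := bmeas_sqr bfg; have b2 := bmeasM bfg (bJ chi).
have b2' := bmeasM (bmeas_cst c^*) b2; have b3 := bmeasJ b2'.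
have Ifg : I (fun x => (f x - g s x) * (chi x)^*) = c.
  have bf' := bmeasM bf (bJ chi); have bg' := bmeasM (bg s) (bJ chi).
  rewrite (_ : (fun x => _) = (fun x => f x * (chi x)^* - g s x * (chi x)^*)).
    by rewrite (CintegralB _ bf' bg') gO// subr0.
  by apply/funext => x; rewrite mulrBl.
rewrite (_ : (fun x => _) = (fun x => `|f x - g s x| ^+ 2 -
    (c^* * ((f x - g s x) * (chi x)^*) + (c^* * ((f x - g s x) * (chi x)^*))^*)
    + `|c| ^+ 2)).
  rewrite (CintegralD _ (bmeasB b1 (bmeasD b2' b3)) (bmeas_cst _)).
  rewrite (CintegralB _ b1 (bmeasD b2' b3)) (CintegralD _ b2' b3).
  rewrite (CintegralJ _ b2') (CintegralZ _ _ b2) Ifg Cintegral_cst IH//.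
  by rewrite rmorphM /= conjCK -normCKC normCK; ring.
apply/funext => x; rewrite /g big_cons -/c -/(g s x) opprD addrCA addrC.
set F := f x - g s x.
have cc : `|chi x| ^+ 2 = 1 by rewrite chi1 expr1n.
rewrite !normCK in cc *; rewrite rmorphB !rmorphM /= !conjCK.
transitivity (F * F^* - (c^* * (F * (chi x)^*) + c * (F^* * chi x)) +
  c * c^* * (chi x * (chi x)^*)); first by ring.
by rewrite cc mulr1.
Qed.

Lemma Lp_bounded_version f : Lp_function m +oo (f : gen_sigma G S -> C R) ->
  exists f' : G -> C R, [/\ bmeas (f' : gen_sigma G S -> C R),
    measurable_fun setT (f' : gen_sigma G S -> borelC R) &
    {ae m, forall x, f x = f' x}].
Proof.
move=> [mf]; rewrite Lnorm.unlock; case: ifPn => [_|/negP[]]; last first.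
  by have := probability_setT m => /= ->; exact: lte01.
move=> /ereal_inf_lt[y /= fy yoo].
have [M yM] : exists M : R, (y <= M%:E)%E.
  by case: y yoo {fy} => [r _|//|_]; [exists r|exists 0; exact: leNye].
have fM : {ae m, forall x, Normc.normc (f x) <= M}.
  apply: filterS fy => x fxy; rewrite -lee_fin (le_trans _ yM)//.
  by apply: le_trans fxy => /=; rewrite lee_fin ler_norm.
pose D : set G := [set x | Normc.normc (f x) <= M].
pose f' x := if `[< D x >] then f x else 0.
have /measurable_borelC mf0 := mf.
have mD' : measurable (~` D : set (gen_sigma G S)).
  rewrite (_ : ~` D = f @^-1` [set z | M < Normc.normc z]).
    by apply: mf0; exact: open_normc_gt.
  by apply/seteqP; split=> x /=; rewrite /D /= ltNge => /negP.
have mf' (U : set (C R)) : open U -> measurable (f' @^-1` U : set (gen_sigma G S)).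
  move=> oU; have mDU : measurable (f @^-1` U `&` D : set (gen_sigma G S)).
    apply: measurableI; first exact: mf0.
    by rewrite -(setCK D); exact: measurableC.
  have [U0|U0] := pselect (U 0).
    rewrite (_ : f' @^-1` U = (f @^-1` U `&` D) `|` ~` D).
      exact: measurableU.
    apply/seteqP; split=> x /=; rewrite /f'; case: asboolP => Dx.
    - by left.
    - by right.
    - by case=> [[]|/(_ Dx)].
    - by [].
  rewrite (_ : f' @^-1` U = f @^-1` U `&` D); first exact: mDU.
  apply/seteqP; split=> x /=; rewrite /f'; case: asboolP => Dx //.
  - by case.
  - by case=> _ /Dx.
exists f'; split.
- apply: (@bmeas_open R _ (gen_sigma G S) f' (Num.max M 0)%:C%C) => // x.
  rewrite /f'; case: asboolP => Dx.
    by rewrite normc_def lecR le_max; apply/orP; left; move: Dx; rewrite /D /=; case: (f x).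
  by rewrite normr0 lecR le_max lexx orbT.
- exact/measurable_borelC.
- have FF := @ae_filter_ringOfSetsType _ (gen_sigma G S) R m.
  by apply: (filterS _ fM) => x fx; rewrite /f' asboolT.
Qed.

Lemma fourier_ae f f' : measurable_fun setT (f : gen_sigma G S -> borelC R) ->
  measurable_fun setT (f' : gen_sigma G S -> borelC R) ->
  {ae m, forall x, f x = f' x} ->
  forall chi, fourier m f chi = fourier m f' chi.
Proof.
move=> mf mf' ff' chi; apply: ae_eq_Cintegral => //.
exact/bmeasJ/bmeas_character.
Qed.

Lemma ell2_fourier f : Lp_function m +oo (f : gen_sigma G S -> C R) ->
  ell2 (fourier m (O := O) f).
Proof.
move=> Lf; have [f' [bf' mf' ff']] := Lp_bounded_version Lf.
have [mf _] := Lf; pose N := I (fun x => `|f' x| ^+ 2).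
have N0 : 0 <= N by apply: Cintegral_ge0 => x; exact: exprn_ge0.
rewrite /ell2; apply: (@le_lt_trans _ _ (complex.Re N)%:E); last exact: ltry.
apply: ge_ereal_sup => _ [F [finF _] <-].
rewrite fsbig_finite//= sumEFin lee_fin -lecR -(ge0_ReC N0).
rewrite rmorph_sum /=; have := fourier_bessel bf' (finmap.fset_uniq (fset_set F)).
apply: le_trans; rewrite le_eqVlt; apply/orP; left; apply/eqP.
apply: eq_bigr => chi _; rewrite -(fourier_ae mf mf' ff').
by rewrite rmorphXn.
Qed.

End Bessel.

(** * Consequences of a factorization *)

Lemma measurable_open_fun (R : realType) d (T : measurableType d)
    (B : topologicalZmodType) (phi : T -> B) :
  (forall U : set B, open U -> measurable (phi @^-1` U)) ->
  measurable_fun setT (phi : T -> borel B).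
Proof.
move=> mphi; apply: (@measurability _ _ T (borel B) setT phi (@open B)) => //.
by move=> _ [U oU <-]; rewrite setTI; exact: mphi.
Qed.

Lemma haar_translation_invariant (R : realType) (B : topologicalZmodType)
    (m : probability (borel B) R) : is_haar m -> translation_invariant m.
Proof.
move=> [minv _ _] a E mE; split; last exact: minv.
rewrite -[X in measurable X]setTI.
apply: (@measurable_open_fun R _ (borel B) B (fun x => a + x)) => //.
move=> U oU; apply: sub_sigma_algebra.
exact: (open_comp (fun y _ => @continuous_addl B a y) oU).
Qed.

Section Factorization.
Context {R : realType} {w : set_system nat} {wU : UltraFilter w}.
Context {A : nat -> topologicalZmodType}.
Local Notation AA := (ultraproduct wU A).
Local Notation SO := (strongly_open wU A).
Context (mu : probability (gen_sigma AA SO) R).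
Hypothesis w_nonprincipal : forall n : nat, w <> principal_filter n.
Hypothesis mu_inv : translation_invariant mu.
Context {B : topologicalZmodType} (mB : probability (borel B) R).
Context (phi : AA -> B) (h : B -> C R) (f : AA -> C R).
Hypothesis f_Loo : Lp_function mu +oo f.
Hypothesis fact : factorization mu f mB phi h.

Let phiD : {morph phi : x y / x + y}.
Proof. by have [_ [phiD _ _ _] _ _] := fact. Qed.

Let phiO (U : set B) : open U -> uopen (phi @^-1` U).
Proof. by have [_ [_ phiO _ _] _ _] := fact; exact: phiO. Qed.

Let phi_surj b : exists a, phi a = b.
Proof.
by have [_ [_ _ /(_ b Logic.I)[a _ <-] _] _ _] := fact; exists a.
Qed.

Let mB_inv : translation_invariant mB.
Proof. by have [[_ _ /haar_translation_invariant]] := fact. Qed.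

Let cB : compact_group B. Proof. by have [[]] := fact. Qed.

Let scB : @second_countable B. Proof. by have [[]] := fact. Qed.

Let mphi : measurable_fun setT (phi : gen_sigma AA SO -> borel B).
Proof.
apply: (@measurable_open_fun R _ (gen_sigma AA SO)) => U oU.
exact: measurable_uopen (phiO oU).
Qed.

Let phi_pres (S : set (borel B)) : measurable S -> mu (phi @^-1` S) = mB S.
Proof. by have [_ [_ _ _ pres] _ _] := fact; exact: pres. Qed.

Lemma linear_character_pullback (chi : dual R (topology_sigma B)) :
  linear_character (uopen_sigma wU A) (chi \o phi).
Proof.
have [chi1 chiD chiO] := dualP chi; split=> [x|x y|U oU] /=.
- exact: chi1.
- by rewrite phiD chiD.
- exact: (phiO (chiO U oU)).
Qed.

Definition dual_pullback (chi : dual R (topology_sigma B)) :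
  dual R (uopen_sigma wU A) := Dual (asboolT (linear_character_pullback chi)).

Lemma factorization_fourier_measurable : fourier_measurable mu f.
Proof.
have [_ _ [mh _] fh] := fact.
pose FG := @fourier_generators R w wU A.
pose CG := @character_generators R B.
exists (h \o phi); last exact: fh.
have mphi' : measurable_fun setT (phi : gen_sigma AA FG -> gen_sigma B CG).
  apply: (@measurability _ _ (gen_sigma AA FG) (gen_sigma B CG) _ _ CG) => //.
  move=> _ [V [chi [U oU ->]] <-]; rewrite setTI; apply: sub_sigma_algebra.
  by exists (dual_pullback chi), U.
have oCG (V : set (borel B)) : measurable V -> <<s CG >> V.
  apply: smallest_sub; first exact: smallest_sigma_algebra.
  by move=> U oU; exact: (open_character_sigma cB mB_inv).
apply/measurable_borelC => U oU; rewrite comp_preimage.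
rewrite -[X in measurable X]setTI; apply: mphi' => //.
by apply: oCG; move/measurable_borelC : mh; exact.
Qed.


Lemma bounded_factor : exists h' : B -> C R,
  [/\ bmeas (h' : borel B -> C R), measurable_fun setT (h' : borel B -> borelC R),
      {ae mB, forall x, h x = h' x} & {ae mu, forall x, f x = h' (phi x)}].
Proof.
have [_ _ Lh fh] := fact.
have [h' [bh' mh' hh']] := Lp_bounded_version Lh; exists h'; split=> //.
have FF := @ae_filter_ringOfSetsType _ (gen_sigma AA SO) R mu.
have h'p : {ae mu, forall x, h (phi x) = h' (phi x)}.
  have [N [mN N0 sN]] := hh'; exists (phi @^-1` N); split.
  - by rewrite -[X in measurable X]setTI; exact: mphi.
  - by apply: etrans (phi_pres mN) N0.
  - by move=> x /= hx; exact: sN.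
by apply: (filterS2 _ _ fh h'p) => x ->.
Qed.

Let openB_measurable (U : set B) : sopen (topology_sigma B) U ->
  measurable (U : set (borel B)).
Proof. exact: sub_sigma_algebra. Qed.

Let uopen_measurable (U : set AA) : sopen (uopen_sigma wU A) U ->
  measurable (U : set (gen_sigma AA SO)).
Proof. exact: measurable_uopen. Qed.

Lemma ufourier_factor (h' : B -> C R) (psi : dual R (uopen_sigma wU A)) :
  measurable_fun setT (h' : borel B -> borelC R) ->
  {ae mu, forall x, f x = h' (phi x)} ->
  ufourier mu f psi = Cintegral mu (fun x => h' (phi x) * (psi x)^*).
Proof.
move=> mh' fh'; have mf : measurable_fun setT (f : gen_sigma AA SO -> borelC R).
  by case: f_Loo.
have mh'p : measurable_fun setT ((h' \o phi) : gen_sigma AA SO -> borelC R).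
  exact: (measurableT_comp mh' mphi).
exact: (fourier_ae uopen_measurable mf mh'p fh').
Qed.

Lemma fourier_pullback chi : ufourier mu f (dual_pullback chi) = cfourier mB h chi.
Proof.
have [h' [bh' mh' hh' fh']] := bounded_factor; have [_ _ [mh _] _] := fact.
rewrite (ufourier_factor _ mh' fh').
rewrite /cfourier (fourier_ae openB_measurable mh mh' hh') /fourier.
have bchi := bmeas_character openB_measurable chi.
exact: (Cintegral_comp mphi phi_pres (bmeasM bh' (bmeasJ bchi))).
Qed.

(* A character trivial on the kernel of [phi] descends to [B]; the induced
   character is continuous since the ultraproduct is countably compact. *)
Lemma pullback_range (psi : dual R (uopen_sigma wU A)) :
  (forall a, phi a = 0 -> psi a = 1) -> exists chi, psi = dual_pullback chi.
Proof.
move=> psi1; have [psiN psiD psiO] := dualP psi.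
have phiN a : phi (- a) = - phi a.
  apply: (addrI (phi a)); rewrite -phiD !subrr.
  by apply: (addrI (phi 0)); rewrite -phiD !addr0.
have psi_eq a b : phi a = phi b -> psi a = psi b.
  move=> ab; rewrite -{1}(subrK b a) psiD psi1 ?mul1r//.
  by rewrite phiD phiN ab subrr.
have /choice[g gK] := phi_surj.
pose chi b := psi (g b).
have chi_phi a : chi (phi a) = psi a by apply: psi_eq; rewrite gK.
have lchi : linear_character (topology_sigma B) chi.
  split=> [x|x y|V oV].
  - exact: psiN.
  - by rewrite /chi -psiD; apply: psi_eq; rewrite phiD !gK.
  rewrite /= openE => y Vy.
  have [b [bo bn]] := second_countable_seq scB.
  have [_ hB] := cB.
  pose F n := if n is k.+1 then
    (if `[< b k y >] then phi @^-1` (~` closure (b k)) else set0)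
    else psi @^-1` V.
  have [||N NP] := ultraproduct_countably_compact w_nonprincipal (F := F).
  - case=> [|k]; first exact: (psiO V oV).
    rewrite /F; case: asboolP => _; last first.
      exact/strongly_open_uopen/strongly_open0.
    by apply: phiO; exact/closed_openC/closed_closure.
  - apply/seteqP; split=> // a _.
    have [Va|Va] := pselect (V (psi a)); first by exists 0%N.
    have ya : y != phi a.
      by apply/eqP => ya; apply: Va; rewrite -chi_phi -ya.
    move: hB; rewrite open_hausdorff => /(_ _ _ ya)[[U W] /=].
    rewrite !inE; move=> [Uy Wa] [oU oW UW0].
    have [n bny bnU] := bn y U (open_nbhs_nbhs (conj oU Uy)).
    exists n.+1 => //; rewrite /F asboolT//= => /(_ W) [|z [/bnU Uz Wz]].
      exact: open_nbhs_nbhs.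
    by have : (U `&` W) z by []; rewrite UW0.
  have near_b : \forall z \near y, forall n, (n < N)%N -> b n y -> b n z.
    elim: (N) => [|K IH]; first exact: nearW.
    have [bKy|bKy] := pselect (b K y); last first.
      apply: filterS IH => z IHz n; rewrite ltnS leq_eqVlt => /predU1P[->//|].
      exact: IHz.
    have nK : nbhs y (b K) by exact: open_nbhs_nbhs.
    apply: filterS2 IH nK => z IHz bKz n.
    by rewrite ltnS leq_eqVlt => /predU1P[->//|]; exact: IHz.
  apply: filterS near_b => z bz; have [a az] := phi_surj z.
  have [[|n] nN] := NP a; first by rewrite /F /= -chi_phi az.
  rewrite /F; case: asboolP => // bny /= []; apply: subset_closure.
  by rewrite az; apply: bz => //; exact: ltnW.
exists (Dual (asboolT lchi)); apply/val_inj/funext => a /=.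
by rewrite chi_phi.
Qed.

Lemma fourier_support (psi : dual R (uopen_sigma wU A)) :
  ufourier mu f psi != 0 -> exists chi, psi = dual_pullback chi.
Proof.
move=> fpsi; apply: pullback_range => a a0; apply: contrapT => psia.
move/eqP : fpsi; apply.
have [h' [bh' mh' _ fh']] := bounded_factor; have [_ psiD _] := dualP psi.
rewrite (ufourier_factor _ mh' fh').
have b1 := bmeasM (bmeas_comp mphi bh') (bmeasJ (bmeas_character uopen_measurable psi)).
set J := Cintegral _ _; have : J = (psi a)^* * J.
  rewrite -CintegralZ; last exact: b1.
  rewrite /J -(Cintegral_addl mu_inv a b1); congr Cintegral; apply/funext => x /=.
  by rewrite phiD a0 add0r psiD rmorphM mulrCA.
move=> /eqP; rewrite -subr_eq0 -{1}[J]mul1r -mulrBl mulf_eq0 => /predU1P[|/eqP//].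
move=> /eqP; rewrite subr_eq0 => /eqP psia1; exfalso; apply: psia.
by rewrite -[psi a]conjCK -psia1 rmorph1.
Qed.

Lemma factorization_ell2_isomorphic :
  ell2_isomorphic (cfourier mB h) (ufourier mu f).
Proof.
have [_ _ Lh _] := fact.
apply: (@ell2_isomorphic_embedding _ _ _ _ _ dual_pullback).
- exact: (ell2_fourier mB_inv openB_measurable Lh).
- exact: (ell2_fourier mu_inv uopen_measurable f_Loo).
- by move=> chi chi'; apply/val_inj.
- move=> chi chi' cc; apply/val_inj/funext => b; have [a <-] := phi_surj b.
  by move/(congr1 (fun c : dual R (uopen_sigma wU A) => c a)) : cc.
- by move=> chi; rewrite fourier_pullback.
- exact: fourier_support.
Qed.

End Factorization.

(** * The image of countably many characters *)

Section CharacterImage.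
Context {R : realType} {G : zmodType} {O : sigma_topology G}.

Definition character_image (c : nat -> dual R O) : Type :=
  {x : nat -> C R | `[< exists a, forall n, x n = c n a >]}.

Variable c : nat -> dual R O.
Local Notation B := (character_image c).

HB.instance Definition _ := Choice.on B.

Lemma character_imageP (x : B) : exists a, forall n, sval x n = c n a.
Proof. by case: x => x /= /asboolP. Qed.

Definition joint_eval (a : G) : B :=
  exist _ (fun n => c n a) (asboolT (ex_intro _ a (fun n => erefl))).

Lemma joint_eval_surj (x : B) : exists a, joint_eval a = x.
Proof.
have [a xa] := character_imageP x; exists a.
by apply/val_inj/funext => n; rewrite /= xa.
Qed.

Definition image_repr (x : B) : G := sval (cid (joint_eval_surj x)).

(* Addition through chosen preimages is the pointwise product of values; this
   spares a proof that the range is closed under it. *)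
Definition image_zero : B := joint_eval 0.
Definition image_opp (x : B) : B := joint_eval (- image_repr x).
Definition image_add (x y : B) : B :=
  joint_eval (image_repr x + image_repr y).

Lemma image_reprE (x : B) n : c n (image_repr x) = sval x n.
Proof. by rewrite -{2}(svalP (cid (joint_eval_surj x))). Qed.

Lemma character0 (chi : dual R O) : chi 0 = 1.
Proof.
have [chi1 chiD _] := dualP chi; have chi0 : chi 0 != 0.
  by rewrite -normr_gt0 chi1.
by apply: (mulIf chi0); rewrite -chiD addr0 mul1r.
Qed.

Lemma characterN (chi : dual R O) a : chi (- a) = (chi a)^*.
Proof.
have [chi1 chiD _] := dualP chi; have chia : chi a != 0.
  by rewrite -normr_gt0 chi1.
by apply: (mulIf chia); rewrite -chiD addNr character0 mulrC -normCK chi1 expr1n.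
Qed.

Lemma sval_image_add (x y : B) n : sval (image_add x y) n = sval x n * sval y n.
Proof.
rewrite /= ; have [_ -> _] := dualP (c n); by rewrite !image_reprE.
Qed.

Lemma sval_image_opp (x : B) n : sval (image_opp x) n = (sval x n)^*.
Proof. by rewrite /= characterN image_reprE. Qed.

Lemma image_val_inj (x y : B) : (forall n, sval x n = sval y n) -> x = y.
Proof. by move=> xy; apply/val_inj/funext. Qed.

Lemma norm_sval_image (x : B) n : `|sval x n| = 1.
Proof.
by have [a ->] := character_imageP x; have [-> _ _] := dualP (c n).
Qed.

Lemma image_addA : associative image_add.
Proof.
by move=> x y z; apply: image_val_inj => n; rewrite !sval_image_add mulrA.
Qed.

Lemma image_addC : commutative image_add.
Proof. by move=> x y; apply: image_val_inj => n; rewrite !sval_image_add mulrC. Qed.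

Lemma image_add0 : left_id image_zero image_add.
Proof.
move=> x; apply: image_val_inj => n.
by rewrite sval_image_add /= character0 mul1r.
Qed.

Lemma image_addN : left_inverse image_zero image_opp image_add.
Proof.
move=> x; apply: image_val_inj => n.
by rewrite sval_image_add sval_image_opp mulrC -normCK norm_sval_image expr1n /= character0.
Qed.

HB.instance Definition _ := GRing.isZmodule.Build B
  image_addA image_addC image_add0 image_addN.

Lemma joint_evalD : {morph joint_eval : a b / a + b}.
Proof.
move=> a b; apply: image_val_inj => n; rewrite [RHS]sval_image_add /=.
by have [_ -> _] := dualP (c n).
Qed.

Definition image_ball (x : B) (n : nat) : set B :=
  [set y | forall j, (j < n)%N -> `|sval x j - sval y j| < n.+1%:R^-1].

Definition image_nbhs (x : B) : set_system B :=
  [set U | exists n, image_ball x n `<=` U].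

HB.instance Definition _ := hasNbhs.Build B image_nbhs.

Lemma image_ball_le (x : B) (n k : nat) : (n <= k)%N ->
  image_ball x k `<=` image_ball x n.
Proof.
move=> nk y xy j jn; apply: lt_le_trans (xy j (leq_trans jn nk)) _.
by rewrite lef_pV2 ?posrE ?ltr0n// ler_nat.
Qed.

Lemma image_ball_center (x : B) n : image_ball x n x.
Proof. by move=> j _; rewrite subrr normr0 invr_gt0. Qed.

Lemma image_nbhs_filter (x : B) : ProperFilter (nbhs x).
Proof.
split; first by move=> [n /(_ x (@image_ball_center x n))].
split.
- by exists 0%N.
- move=> U V [n nU] [k kV]; exists (maxn n k) => y xy; split.
    by apply: nU; apply: image_ball_le xy; exact: leq_maxl.
  by apply: kV; apply: image_ball_le xy; exact: leq_maxr.
- by move=> U V UV [n nU]; exists n; exact: subset_trans UV.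
Qed.

Lemma image_nbhs_singleton (x : B) (U : set B) : nbhs x U -> U x.
Proof. by move=> [n]; apply; exact: image_ball_center. Qed.

Lemma image_nbhs_nbhs (x : B) (U : set B) : nbhs x U -> nbhs x (nbhs^~ U).
Proof.
move=> [n nU]; exists n.*2.+1 => y xy; exists n.*2.+1 => z yz; apply: nU => j jn.
have jn2 : (j < n.*2.+1)%N by rewrite ltnS (leq_trans (ltnW jn))// -addnn leq_addr.
rewrite -(subrK (sval y j) (sval x j)) -addrA (le_lt_trans (ler_normD _ _))//.
have -> : n.+1%:R^-1 = n.*2.+2%:R^-1 + n.*2.+2%:R^-1 :> C R.
  rewrite -doubleS -muln2 natrM invfM -mulrDr (_ : 2^-1 + 2^-1 = 1) ?mulr1//.
  by field.
by rewrite ltrD// ?xy// yz.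
Qed.

HB.instance Definition _ := Nbhs_isNbhsTopological.Build B
  image_nbhs_filter image_nbhs_singleton image_nbhs_nbhs.

Lemma cvg_image (I : Type) (F : set_system I) (u : I -> B) (x : B) : Filter F ->
  (forall n, (fun i => sval (u i) n) @ F --> sval x n) -> u @ F --> x.
Proof.
move=> FF ux U [n nU]; have : \forall i \near F, image_ball x n (u i).
  rewrite /image_ball /=.
  have n0 : 0 < (n.+1%:R^-1 : C R) by rewrite invr_gt0.
  suff H k : \forall i \near F, forall j, (j < k)%N ->
      `|sval x j - sval (u i) j| < n.+1%:R^-1 by exact: H.
  elim: k => [|k IH]; first exact: nearW.
  have /cvgrPdist_lt/(_ _ n0) uk := @ux k.
  apply: filterS2 IH uk => i IHi uki j.
  by rewrite ltnS leq_eqVlt => /predU1P[->//|]; exact: IHi.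
by apply: filterS => i; exact: nU.
Qed.

Lemma image_coord_continuous n : continuous (fun x : B => sval x n : C R).
Proof.
move=> x; have FF : Filter (nbhs x) := nbhs_filter x.
apply/(@cvgrPdist_lt _ _ _ (nbhs x) FF) => e e0; have [k ke] := gt0_natC e0.
exists (maxn n.+1 k) => y /= xy; apply: lt_trans ke.
apply: (lt_le_trans (xy n _)); first by rewrite leq_max ltnSn.
by rewrite lef_pV2 ?posrE ?ltr0n// ler_nat ltnS leq_maxr.
Qed.

Lemma image_sub_continuous : continuous (fun x : B * B => x.1 - x.2).
Proof.
move=> [x y]; apply: cvg_image => n.
have c1 : (fun z : B * B => sval z.1 n) @ (x, y) --> (sval x n : C R).
  by apply: (@cvg_comp _ _ _ fst (fun z : B => sval z n : C R));
    [exact: cvg_fst|exact: image_coord_continuous].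
have c2 : (fun z : B * B => (sval z.2 n)^* : C R) @ (x, y) --> ((sval y n)^* : C R).
  apply: cvg_conjC.
  by apply: (@cvg_comp _ _ _ snd (fun z : B => sval z n : C R));
    [exact: cvg_snd|exact: image_coord_continuous].
have e (z1 z2 : B) : sval (z1 - z2) n = sval z1 n * (sval z2 n)^*.
  by rewrite [LHS]sval_image_add sval_image_opp.
have E : (fun i : B * B => sval (i.1 - i.2) n) =
    (fun z : B * B => sval z.1 n * (sval z.2 n)^*).
  by apply/funext => z; exact: e.
rewrite E.
have -> : sval ((x, y).1 - (x, y).2) n = sval x n * (sval y n)^* := e x y.
exact: (cvgM c1 c2).
Qed.

HB.instance Definition _ := PreTopologicalNmodule_isTopologicalZmodule.Build B
  image_sub_continuous.

Lemma image_hausdorff : hausdorff_space B.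
Proof.
move=> x y xy; apply: image_val_inj => n; apply: contrapT => xyn.
have := C_hausdorff (R := R); rewrite open_hausdorff.
have /[swap] /[apply] : (sval x n : C R) != sval y n by exact/eqP.
move=> [[U V] /=]; rewrite !inE; move=> [Ux Vy] [oU oV UV0].
have nU : nbhs x [set z : B | U (sval z n)].
  exact: (@image_coord_continuous n x U (open_nbhs_nbhs (conj oU Ux))).
have nV : nbhs y [set z : B | V (sval z n)].
  exact: (@image_coord_continuous n y V (open_nbhs_nbhs (conj oV Vy))).
have [z [zU zV]] := xy _ _ nU nV.
have : (U `&` V) (sval z n) by [].
by rewrite UV0.
Qed.

Definition image_cylinder (b : nat -> set (C R)) (s : seq nat) : set B :=
  [set x | forall j, (j < size s)%N -> b (nth 0%N s j) (sval x j)].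

Lemma image_base : exists b : nat -> set (C R), [/\ forall n, open (b n),
  forall z U, nbhs z U -> exists2 n, b n z & b n `<=` U,
  forall s, open (image_cylinder b s) &
  forall (x : B) U, nbhs x U -> exists2 s, image_cylinder b s x & image_cylinder b s `<=` U].
Proof.
have [b [bo bn]] := @C_base R; exists b; split=> // [s|x U [n nU]].
  rewrite openE => x xs; suff H k : (k <= size s)%N -> \forall y \near x,
      forall j, (j < k)%N -> b (nth 0%N s j) (sval y j) by exact: (H (size s) (leqnn _)).
  have FF : Filter (nbhs x) := nbhs_filter x.
  elim: k => [_|k IH ks]; first by exists 0%N.
  have xk : nbhs x [set y : B | b (nth 0%N s k) (sval y k)].
    apply: (@image_coord_continuous k x); apply: open_nbhs_nbhs; split=> //.
    exact: xs.
  apply: filterS2 (IH (ltnW ks)) xk => y IHy yk j.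
  by rewrite ltnS leq_eqVlt => /predU1P[->//|]; exact: IHy.
have n0 : 0 < (n.+1%:R^-1 : C R) by rewrite invr_gt0.
have /choice[k kP] : forall j, exists k, b k (sval x j) /\
    b k `<=` ball (sval x j : C R) n.+1%:R^-1.
  move=> j; have [k bk kb] := bn _ _ (nbhsx_ballx (sval x j : C R) _ n0).
  by exists k.
exists (mkseq k n).
  by move=> j; rewrite size_mkseq => jn; rewrite nth_mkseq//; case: (kP j).
move=> y yP; apply: nU => j jn.
have := yP j; rewrite size_mkseq => /(_ jn); rewrite nth_mkseq//.
by move=> /(kP j).2; rewrite /ball /=.
Qed.

Lemma image_second_countable : @second_countable B.
Proof.
have [b [_ _ co cn]] := image_base.
exists (range (image_cylinder b)); first exact: sub_countable (card_image_le _ _) (countableP _).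
split; first by move=> _ [s _ <-]; exact: co.
move=> x U /cn[s xs sU]; by exists (image_cylinder b s).
Qed.

Lemma joint_eval_open (U : set B) : open U -> sopen O (joint_eval @^-1` U).
Proof.
move=> oU; have [b [bo _ co cn]] := image_base.
have sc s : sopen O (joint_eval @^-1` image_cylinder b s).
  rewrite (_ : _ @^-1` _ = [set a | forall j, (j < size s)%N ->
      b (nth 0%N s j) (c j a)])//.
  elim: (size s) => [|n IH].
    by rewrite (_ : [set a | _] = setT) ?predeqE//; exact: sopenT.
  rewrite (_ : [set a | _] = [set a | forall j, (j < n)%N -> b (nth 0%N s j) (c j a)]
    `&` (c n @^-1` b (nth 0%N s n))).
    by apply: sopenI => //; have [_ _ cO] := dualP (c n); exact: cO.
  apply/seteqP; split=> a /=.
    by move=> H; split=> [j jn|]; [exact: (H j (ltnW jn))|exact: (H n (ltnSn n))].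
  by move=> [H Hn] j; rewrite ltnS leq_eqVlt => /predU1P[->//|]; exact: H.
pose P (o : option (seq nat)) : set G :=
  if o is Some s then if `[< image_cylinder b s `<=` U >] then
    joint_eval @^-1` image_cylinder b s else set0 else set0.
rewrite (_ : joint_eval @^-1` U = \bigcup_n P (unpickle n)).
  apply: sopen_bigcup => n; rewrite /P; case: unpickle => [s|]; last exact: sopen0.
  by case: ifP => _ //; exact: sopen0.
apply/seteqP; split=> [a Ua|a [n _]].
  have [s sa sU] := cn _ _ (open_nbhs_nbhs (conj oU Ua)).
  by exists (pickle s) => //; rewrite pickleK /P asboolT.
by rewrite /P; case: unpickle => [s|//]; case: asboolP => // sU; exact: sU.
Qed.

End CharacterImage.

(** * Regularity *)

Section Regularity.
Context {R : realType} {B : topologicalZmodType}.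
Hypotheses (cB : compact_group B) (scB : @second_countable B).
Context (m : probability (borel B) R).
Local Notation msr E := (measurable (E : set (borel B))).

Lemma open_msr (U : set B) : open U -> msr U.
Proof. exact: sub_sigma_algebra. Qed.

Lemma closed_msr (K : set B) : closed K -> msr K.
Proof.
move=> cK; rewrite -[X in measurable X]setCK; apply: measurableC.
exact: (open_msr (closed_openC cK)).
Qed.

Definition approximable (E : set B) := forall e : R, 0 < e ->
  exists K U, [/\ closed K, open U, K `<=` E, E `<=` U &
    (m (U `\` K : set (borel B)) <= e%:E)%E].

Lemma vanishing_tail (D : set B) (F : nat -> set B) (e : R) : 0 < e -> msr D ->
  (forall n, msr (F n)) -> D `<=` \bigcup_n F n ->
  exists N, (m (D `\` \bigcup_(n in `I_N) F n : set (borel B)) <= e%:E)%E.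
Proof.
move=> e0 mD mF DF; pose T N : set (borel B) := D `\` \bigcup_(n in `I_N) F n.
have mT N : measurable (T N).
  by apply: measurableD => //; apply: bigcup_measurable => n _; exact: mF.
have T0 : \bigcap_N T N = set0.
  apply/seteqP; split=> // x Tx; have [Dx _] := Tx 0%N Logic.I.
  have [n _ Fx] := DF x Dx; have [_ nF] := Tx n.+1 Logic.I.
  by apply: nF; exists n => //=.
have : m \o T @ \oo --> m (\bigcap_N T N).
  apply: nonincreasing_cvg_mu => //.
  - exact: le_lt_trans (probability_le1 _ (mT 0%N)) (ltry _).
  - by rewrite T0; exact: measurable0.
  - move=> i j ij; apply/subsetPset => x [Dx nx]; split=> // -[n ni Fx].
    by apply: nx; exists n => //=; exact: leq_trans ni ij.
rewrite T0 measure0 => /fine_cvgP[ffin fcvg].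
have /cvgrPdist_lt/(_ _ e0) ft := fcvg.
have [N [fN eN]] := filter_ex (filterI ffin ft); exists N.
rewrite -[leLHS](fineK fN) lee_fin; apply: ltW; apply: le_lt_trans eN.
by rewrite sub0r normrN /= ler_norm.
Qed.

Lemma approximable_open (U : set B) : open U -> approximable U.
Proof.
move=> oU e e0; have [b [bo bn]] := second_countable_seq scB.
have [cT hB] := cB.
pose F n := if `[< closure (b n) `<=` U >] then closure (b n) else set0.
have cF n : closed (F n).
  by rewrite /F; case: ifP => _; [exact: closed_closure|exact: closed0].
have FU n : F n `<=` U by rewrite /F; case: asboolP => // _; exact: sub0set.
have UF : U `<=` \bigcup_n F n.
  move=> x Ux; have nU : nbhs x U by exact: open_nbhs_nbhs.
  have [V xV VU] := compact_regular hB cT (filterT : nbhs x setT) nU.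
  have [n bx bV] := bn _ _ xV; exists n => //; rewrite /F asboolT.
    exact: subset_closure.
  by apply: subset_trans VU; exact: closureS.
have [N mN] := vanishing_tail e0 (open_msr oU) (fun n => closed_msr (cF n)) UF.
exists (\bigcup_(n in `I_N) F n), U; split=> //.
- by apply: closed_bigcup => // n _; exact: cF.
- by move=> x [n _ /FU].
Qed.

Lemma approximable_sigma_algebra : sigma_algebra setT approximable.
Proof.
split.
- move=> e e0; exists set0, set0; split=> //; [exact: closed0|exact: open0|].
  by rewrite setDv measure0 lee_fin ltW.
- move=> E aE e e0; have [K [U [cK oU KE EU mKU]]] := aE e e0.
  exists (~` U), (~` K); split.
  + exact: open_closedC.
  + exact: closed_openC.
  + by rewrite setTD; exact: subsetC.
  + by rewrite setTD; exact: subsetC.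
  + by rewrite setDE setCK setIC -setDE.
- move=> E aE e e0; have e20 : 0 < e / 2 by rewrite divr_gt0.
  have /choice[K KP] : forall n, exists K, exists U, [/\ closed K, open U,
      K `<=` E n, E n `<=` U &
      (m (U `\` K : set (borel B)) <= (e / 2 / (2 ^ n.+1)%:R)%:E)%E].
    by move=> n; apply: aE; rewrite divr_gt0// ltr0n expn_gt0.
  have /choice[U KU] := KP.
  have cK n : closed (K n) by case: (KU n).
  have oU n : open (U n) by case: (KU n).
  have KE n : K n `<=` E n by case: (KU n).
  have EU n : E n `<=` U n by case: (KU n).
  have mK n : msr (K n) by exact: (closed_msr (cK n)).
  have mU n : msr (U n) by exact: (open_msr (oU n)).
  pose K' := \bigcup_n K n; pose U' := \bigcup_n U n.
  have mK' : msr K' by exact: bigcupT_measurable.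
  have mU' : msr U' by exact: bigcupT_measurable.
  have [N KN] := vanishing_tail e20 mK' mK (@subset_refl _ K').
  have cN : closed (\bigcup_(n in `I_N) K n) by apply: closed_bigcup.
  exists (\bigcup_(n in `I_N) K n), U'; split=> //.
  + by apply: bigcup_open => n _; exact: oU.
  + by move=> x [n _ /KE Ex]; exists n.
  + by move=> x [n _ /EU Ux]; exists n.
  have mUK : (m (U' `\` K' : set (borel B)) <= (e / 2)%:E)%E.
    apply: (@le_trans _ _ (\sum_(n <oo) m (U n `\` K n : set (borel B)))%E).
      apply: measure_sigma_subadditive.
      * by move=> n; apply: measurableD.
      * exact: measurableD.
      * move=> x [[n _ Ux] nK]; exists n => //; split=> // Kx; apply: nK.
        by exists n.
    apply: (@le_trans _ _ (\sum_(n <oo) (e / 2 / (2 ^ n.+1)%:R)%:E)%E); last first.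
      by apply: epsilon_trick0; exact: ltW.
    apply: lee_nneseries => // n _; by case: (KU n).
  have mKN : msr (\bigcup_(n in `I_N) K n) by exact: closed_msr.
  apply: (@le_trans _ _ (m ((U' `\` K') `|` (K' `\` \bigcup_(n in `I_N) K n)
      : set (borel B)))).
    apply: le_measure; rewrite ?inE.
    * exact: measurableD.
    * by apply: measurableU; exact: measurableD.
    * move=> x [Ux nx]; have [Kx|Kx] := pselect (K' x); [by right|by left].
  have m1 := measurableD mU' mK'; have m2 := measurableD mK' mKN.
  apply: (le_trans (measureU2 m m1 m2)).
  by rewrite [e]splitr EFinD leeD.
Qed.

(* In a second countable compact group every open set is F_sigma, hence every
   finite Borel measure is regular. *)
Lemma second_countable_haar : translation_invariant m -> is_haar m.
Proof.
move=> minv; have app E : msr E -> approximable E.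
  apply: smallest_sub; first exact: approximable_sigma_algebra.
  by move=> U; exact: approximable_open.
split=> [a E mE|E mE|E mE]; first exact: (minv a E mE).2.
- apply/eqP; rewrite eq_le; apply/andP; split.
    apply: le_ereal_inf_tmp => _ [U [oU EU] <-].
    by apply: le_measure => //; rewrite inE//; exact: open_msr.
  apply/lee_addgt0Pr => e e0; have [K [U [cK oU KE EU mUK]]] := app E mE e e0.
  apply: (@le_trans _ _ (m (U : set (borel B)))).
    by apply: ereal_inf_lbound; exists U.
  have mU := open_msr oU; have mK := closed_msr cK.
  rewrite -(setDUK (subset_trans KE EU)).
  apply: (le_trans (measureU2 m mK (measurableD mU mK))).
  by apply: leeD => //; apply: le_measure; rewrite ?inE.
- apply/eqP; rewrite eq_le; apply/andP; split; last first.
    apply: ge_ereal_sup => _ [K [cK KE] <-].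
    have [_ hB] := cB.
    by apply: le_measure => //; rewrite inE//; exact: (closed_msr (compact_closed hB cK)).
  apply/lee_addgt0Pr => e e0; have [K [U [cK oU KE EU mUK]]] := app E mE e e0.
  have mU := open_msr oU; have mK := closed_msr cK.
  rewrite -(setDUK KE).
  apply: (le_trans (measureU2 m mK (measurableD mE mK))).
  apply: leeD.
    apply: ereal_sup_ubound; exists K => //; split=> //.
    by apply: (subclosed_compact cK (proj1 cB)).
  apply: le_trans mUK; apply: le_measure; rewrite ?inE.
  + exact: measurableD.
  + exact: measurableD.
  + exact: setSD.
Qed.

End Regularity.

Section CountableGeneration.
Context {R : realType} {G : zmodType} {O : sigma_topology G}.
Implicit Types c : nat -> dual R O.

Definition coordinate_generators c : set (set G) :=
  [set V | exists n, exists2 U : set (C R), open U & V = c n @^-1` U].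

Lemma coordinate_sigma_sub c c' : (forall n, exists k, c n = c' k) ->
  <<s coordinate_generators c >> `<=` <<s coordinate_generators c' >>.
Proof.
move=> cc'; apply: smallest_sub; first exact: smallest_sigma_algebra.
move=> _ [n [U oU ->]]; have [k ->] := cc' n; apply: sub_sigma_algebra.
by exists k, U.
Qed.

Lemma coordinate_sigma_bigcup (P : nat -> set G) :
  (forall n, exists c, <<s coordinate_generators c >> (P n)) ->
  exists c, forall n, <<s coordinate_generators c >> (P n).
Proof.
move=> /choice[d dP].
exists (fun j => if (unpickle j : option (nat * nat)) is Some p then d p.1 p.2 else dual_one).
move=> n; apply: coordinate_sigma_sub (dP n) => k.
by exists (pickle (n, k)); rewrite pickleK.
Qed.

Lemma countably_many_characters (E : set G) :
  <<s [set V | exists chi : dual R O, exists2 U : set (C R), open U & V = chi @^-1` U] >> E ->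
  exists c, <<s coordinate_generators c >> E.
Proof.
apply: (smallest_sub (X := [set E | exists c, <<s coordinate_generators c >> E])).
- have sa c := smallest_sigma_algebra setT (coordinate_generators c).
  split.
  + by exists (fun=> dual_one); have [] := sa (fun=> dual_one).
  + by move=> V [c cV]; exists c; have [_ + _] := sa c; exact.
  + move=> F /coordinate_sigma_bigcup[c cF]; exists c.
    by have [_ _] := sa c; exact.
- move=> _ [chi [U oU ->]]; exists (fun=> chi); apply: sub_sigma_algebra.
  by exists 0%N, U.
Qed.

End CountableGeneration.

(** * Existence of a factorization *)

Section FactorizationExists.
Context {R : realType} {w : set_system nat} {wU : UltraFilter w}.
Hypothesis w_nonprincipal : forall n : nat, w <> principal_filter n.
Context {A : nat -> topologicalZmodType}.
Local Notation AA := (ultraproduct wU A).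
Local Notation SO := (strongly_open wU A).
Local Notation dualAA := (dual R (uopen_sigma wU A)).
Context (mu : probability (gen_sigma AA SO) R).
Hypothesis mu_inv : translation_invariant mu.

Lemma countably_compact_image (B : topologicalType) (phi : AA -> B) :
  @second_countable B -> (forall U : set B, open U -> uopen (phi @^-1` U)) ->
  (forall b, exists a, phi a = b) -> compact [set: B].
Proof.
move=> /second_countable_seq[b [bo bn]] phiO phi_surj F PF _.
apply: contrapT => nocl.
pose good n := exists2 E, F E & b n `&` E = set0.
pose D n := phi @^-1` (if `[< good n >] then b n else set0).
have [||N NP] := ultraproduct_countably_compact w_nonprincipal (F := D).
- by move=> n; apply: phiO; case: ifP => _; [exact: bo|exact: open0].
- apply/seteqP; split=> // a _; apply: contrapT => na; apply: nocl.
  exists (phi a); split=> // E V FE nV; apply: contrapT => EV.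
  have [n bna bnV] := bn _ _ nV; apply: na; exists n => //.
  rewrite /D /= asboolT//; exists E => //; apply/seteqP; split=> // x [/bnV Vx Ex].
  by apply: EV; exists x.
have H K : \forall x \near F, forall n, (n < K)%N -> good n -> ~ b n x.
  elim: K => [|K IH]; first exact: nearW.
  have [[E FE bE]|ng] := pselect (good K); last first.
    apply: filterS IH => x IHx n; rewrite ltnS leq_eqVlt => /predU1P[->//|].
    exact: IHx.
  apply: filterS2 IH FE => x IHx Ex n; rewrite ltnS leq_eqVlt => /predU1P[->|].
    by move=> _ bx; have : (b K `&` E) x by []; rewrite bE.
  exact: IHx.
have [x xN] := filter_ex (H N); have [a ax] := phi_surj x.
have [n nN] := NP a; rewrite /D /= ax; case: asboolP => // gn bx.
exact: (xN n nN gn).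
Qed.

Lemma coordinate_sigma_preimage (c : nat -> dualAA) (E : set AA) :
  <<s coordinate_generators c >> E ->
  exists2 V : set (borel (character_image c)), measurable V &
    E = joint_eval c @^-1` V.
Proof.
apply: (smallest_sub (X := [set E | exists2 V : set (borel (character_image c)),
  measurable V & E = joint_eval c @^-1` V])).
- split.
  + by exists set0; [exact: measurable0|rewrite preimage_set0].
  + move=> _ [V mV ->]; exists (~` V); first exact: measurableC.
    by rewrite setTD preimage_setC.
  + move=> F FP; have /choice[V VP] : forall n, exists V : set (borel _),
        measurable V /\ F n = joint_eval c @^-1` V.
      by move=> n; have [V mV FV] := FP n; exists V.
    exists (\bigcup_n V n).
      by apply: bigcupT_measurable => n; case: (VP n).
    by rewrite preimage_bigcup; apply: eq_bigcup => // n _; case: (VP n).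
- move=> _ [n [U oU ->]]; exists ((fun x : character_image c => sval x n : C R) @^-1` U).
    apply: sub_sigma_algebra; apply: open_comp => // x _.
    exact: image_coord_continuous.
  by [].
Qed.

Lemma fourier_measurable_factorization f : Lp_function mu +oo f ->
  fourier_measurable mu f ->
  exists (B : topologicalZmodType) (mB : probability (borel B) R)
         (phi : AA -> B) (h : B -> C R), factorization mu f mB phi h.
Proof.
move=> Lf [g /measurable_borelC mg fg]; have [b [bo bn]] := @C_base R.
have [c cP] : exists c : nat -> dualAA,
    forall k, <<s coordinate_generators c >> (g @^-1` b k).
  apply: coordinate_sigma_bigcup => k; apply: countably_many_characters.
  exact: (mg _ (bo k)).
pose B := character_image c; pose phi : AA -> B := joint_eval c.
have phi_surj (x : B) : exists a, phi a = x := joint_eval_surj x.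
have phiO (U : set B) : open U -> uopen (phi @^-1` U) := @joint_eval_open _ _ _ c U.
have phiD : {morph phi : a a' / a + a'} by exact: joint_evalD.
have scB : @second_countable B := image_second_countable c.
have cB : compact_group B.
  by split; [exact: countably_compact_image scB phiO phi_surj|exact: image_hausdorff].
have mphi : measurable_fun setT (phi : gen_sigma AA SO -> borel B).
  apply: (@measurable_open_fun R _ (gen_sigma AA SO)) => U oU.
  exact: measurable_uopen (phiO U oU).
have [mB mBE] := probability_image mu mphi.
have mB_inv : translation_invariant mB.
  move=> x E mE.
  have mE' : measurable ((fun y : B => x + y) @^-1` E : set (borel B)).
    rewrite -[X in measurable X]setTI.
    apply: (@measurable_open_fun R _ (borel B) B (fun y => x + y)) => //.
    move=> U oU; apply: sub_sigma_algebra.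
    exact: (open_comp (fun y _ => @continuous_addl B x y) oU).
  split=> //; have [a ax] := phi_surj x; rewrite !mBE -ax.
  have mphiE : measurable (phi @^-1` E : set (gen_sigma AA SO)).
    by rewrite -[X in measurable X]setTI; exact: mphi.
  rewrite -(mu_inv a mphiE).2; congr (mu _).
  by apply/seteqP; split=> z; rewrite /preimage/= phiD.
have haarB := second_countable_haar cB scB mB_inv.
have /choice[V VP] : forall k, exists V : set (borel B),
    measurable V /\ g @^-1` b k = phi @^-1` V.
  by move=> k; have [V mV gV] := coordinate_sigma_preimage (cP k); exists V.
have mV k : measurable (V k) by case: (VP k).
have gV k : g @^-1` b k = phi @^-1` V k by case: (VP k).
have [s sK] := choice phi_surj.
pose h x := g (s x).
have hV k : h @^-1` b k = V k.
  apply/seteqP; split=> x /=.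
    by move=> bx; have : (g @^-1` b k) (s x) by []; rewrite gV /= sK.
  move=> Vx; suff : (g @^-1` b k) (s x) by [].
  by rewrite gV /= sK.
have hphi a : h (phi a) = g a.
  apply: contrapT => /eqP hg.
  have := C_hausdorff (R := R); rewrite open_hausdorff => /(_ _ _ hg)[[U W] /=].
  rewrite !inE; move=> [Uh Wg] [oU oW UW0].
  have [k bk bU] := bn _ _ (open_nbhs_nbhs (conj oU Uh)).
  have : (g @^-1` b k) a by rewrite gV /= -hV.
  by move=> /bU Ug; have : (U `&` W) (g a) by []; rewrite UW0.
have mh : measurable_fun setT (h : borel B -> borelC R).
  apply/measurable_borelC => U oU.
  rewrite (_ : h @^-1` U = \bigcup_(k in [set k | b k `<=` U]) V k).
    by apply: bigcup_measurable => k _; exact: mV.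
  apply/seteqP; split=> [x Ux|x [k /= bU]]; last by rewrite -hV => /bU.
  have [k bk bU] := bn _ _ (open_nbhs_nbhs (conj oU Ux)).
  by exists k => //; rewrite -hV.
have FF := @ae_filter_ringOfSetsType _ (gen_sigma AA SO) R mu.
have fh : {ae mu, forall x, f x = h (phi x)}.
  by apply: (filterS _ fg) => x ->; rewrite hphi.
exists B, mB, phi, h; split; [by split| | |exact: fh].
- split; [exact: phiD|exact: phiO| |by move=> S _; rewrite mBE].
  by move=> x _; have [a <-] := phi_surj x; exists a.
- split=> //; have [f' [[_ _ [M f'M]] _ ff']] := Lp_bounded_version Lf.
  have hM : {ae mB, forall x, ((Normc.normc (h x))%:E <= (complex.Re M)%:E)%E}.
    have mbad : measurable (h @^-1` [set z | complex.Re M < Normc.normc z] : set (borel B)).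
      by move/measurable_borelC : mh; apply; exact: open_normc_gt.
    exists (h @^-1` [set z | complex.Re M < Normc.normc z]); split=> //.
      rewrite mBE; apply: measure_negligible.
        by rewrite -[X in measurable X]setTI; exact: mphi.
      have : {ae mu, forall x, ~ (phi @^-1` (h @^-1` [set z | complex.Re M < Normc.normc z])) x}.
        apply: (filterS2 _ _ fh ff') => x /= <- ->; apply/negP; rewrite -leNgt.
        exact: ler_normc.
      move=> [N [mN N0 sN]]; exists N; split=> // x xbad; apply: sN => /=.
      by move=> /(_ xbad).
    by move=> x /= /negP; rewrite lee_fin -ltNge.
  rewrite Lnorm.unlock; case: ifPn => [_|_]; last exact: ltry.
  apply: (@le_lt_trans _ _ (complex.Re M)%:E); last exact: ltry.
  apply/ess_sup_inf.ess_supP; have FB := @ae_filter_ringOfSetsType _ (borel B) R mB.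
  apply: (filterS _ hM) => x hx /=; rewrite ger0_norm//.
  by case: (h x) => ? ?; exact: sqrtr_ge0.
Qed.

End FactorizationExists.

Theorem theorem6p5 (R : realType)
    (w : set_system nat) (wU : UltraFilter w)
    (w_nonprincipal : forall n : nat, w <> principal_filter n)
    (A : nat -> topologicalZmodType)
    (A_compact : forall i, compact_group (A i))
    (m : forall i, probability (borel (A i)) R)
    (m_haar : forall i, is_haar (m i))
    (mu : probability (gen_sigma (ultraproduct wU A) (strongly_open wU A)) R)
    (mu_ultralimit : ultralimit_measure m mu)
    (dhat : forall G1 G2 : groupType, (G1 -> C R) -> (G2 -> C R) -> R)
    (dhat_metric : ell2_metric dhat)
    (f : ultraproduct wU A -> C R)
    (f_Loo : Lp_function mu +oo f) :
  (fourier_measurable mu f <->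
   exists (B : topologicalZmodType) (mB : probability (borel B) R)
          (phi : ultraproduct wU A -> B) (h : B -> C R),
     factorization mu f mB phi h) /\
  (forall (B : topologicalZmodType) (mB : probability (borel B) R)
          (phi : ultraproduct wU A -> B) (h : B -> C R),
     factorization mu f mB phi h ->
     ell2_isomorphic (cfourier mB h) (ufourier mu f) /\
     (forall (B' : topologicalZmodType) (mB' : probability (borel B') R)
             (k : B' -> C R),
        in_Q mu f mB' k ->
        dhat _ _ (cfourier mB h) (cfourier mB' k) = 0)).
Proof.
have mu_inv := ultralimit_invariant m_haar mu_ultralimit.
split=> [|B mB phi h fact].
  split; first exact: (fourier_measurable_factorization w_nonprincipal mu_inv f_Loo).
  by move=> [B [mB [phi [h fact]]]]; exact: (factorization_fourier_measurable fact).
have iso := factorization_ell2_isomorphic w_nonprincipal mu_inv f_Loo fact.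
split=> // B' mB' k [_ _ _ kiso].
have [lh _ _] := iso; have [lk _ _] := kiso.
have [_ dhat0] := dhat_metric _ _ _ _ lh lk.
exact: (dhat0 (ell2_isomorphic_joint iso kiso)).
Qed.
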